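(* Let $R(\mathbf{x},\mathbf{x}')$ be a one-directional difference bounds constraint. Then a closed form $\widehat{R}(n,\mathbf{x},\mathbf{x}')$ of $R$ that is a formula in the existential fragment of Presburger arithmetic can be computed in time polynomial in the binary size of $R$.
   Context: Variables range over $\mathbb{Z}$; $\mathbf{x}=\{x_1,\dots,x_N\}$, $\mathbf{x}'=\{x_1',\dots,x_N'\}$. A difference bounds constraint $R(\mathbf{x},\mathbf{x}')$ is one-directional if it is either a conjunction of atoms of the form $x_i-x_j'\le c_{ij}$ (forward) or a conjunction of atoms of the form $x_i'-x_j\le c_{ij}$ (backward), with $c_{ij}\in\mathbb{Z}$. $R^n$ denotes the $n$-fold relational composition of $R$. A closed form of $R$ is a formula $\widehat{R}(n,\mathbf{x},\mathbf{x}')$, with $n$ a fresh integer variable, such that for every integer $m\ge1$, $\widehat{R}[m/n]$ defines $R^m$. *)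

(* Defs.v *)
From Corelib Require Import BinNums.
From mathcomp Require Import all_boot all_order all_algebra.
Set Implicit Arguments.
Unset Strict Implicit.
Unset Printing Implicit Defensive.

Import Order.TTheory GRing.Theory Num.Theory.
Local Open Scope ring_scope.

(* [Cur i] is x_i and [Nxt i] is x_i'; indices start at 0. *)
Inductive dvar (N : nat) : Type :=
| Cur of 'I_N
| Nxt of 'I_N.

(* [DAtom u v c] is the atom u - v <= c. *)
Record datom (N : nat) : Type := DAtom {
  d_pos : dvar N;
  d_neg : dvar N;
  d_bound : int
}.

(* A conjunction of atoms, as a list; the empty list is [true]. *)
Definition dbc (N : nat) : Type := seq (datom N).

Definition state (N : nat) : Type := {ffun 'I_N -> int}.

Definition dvar_val (N : nat) (x x' : state N) (v : dvar N) : int :=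
  match v with Cur i => x i | Nxt i => x' i end.

Definition dbc_rel (N : nat) (R : dbc N) (x x' : state N) : Prop :=
  all (fun a => dvar_val x x' (d_pos a) - dvar_val x x' (d_neg a)
                <= d_bound a) R.

Definition forward_atom (N : nat) (a : datom N) : bool :=
  match d_pos a, d_neg a with Cur _, Nxt _ => true | _, _ => false end.

Definition backward_atom (N : nat) (a : datom N) : bool :=
  match d_pos a, d_neg a with Nxt _, Cur _ => true | _, _ => false end.

Definition one_directional (N : nat) (R : dbc N) : bool :=
  all (@forward_atom N) R || all (@backward_atom N) R.

Fixpoint rel_pow (T : Type) (R : T -> T -> Prop) (n : nat) : T -> T -> Prop :=
  match n with
  | 0%N => fun x y => x = y
  | n'.+1 => fun x y => exists2 z, R x z & rel_pow R n' z y
  end.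

(* [Iter] is the variable n, [Sys v] is one of the x_i, x_i', and the [Aux k]
   form an infinite supply of further variables, the only ones that quantifiers
   bind. *)
Inductive pvar (N : nat) : Type :=
| Iter
| Sys of dvar N
| Aux of nat.
Arguments Iter {N}.
Arguments Aux {N} k.

Inductive pterm (N : nat) : Type :=
| PVar of pvar N
| PConst of int
| PAdd of pterm N & pterm N
| PScale of int & pterm N.
Arguments PConst {N} c.

Inductive pform (N : nat) : Type :=
| PLe of pterm N & pterm N
| PEq of pterm N & pterm N
| PNot of pform N
| PAnd of pform N & pform N
| POr of pform N & pform N
| PEx of nat & pform N
| PAll of nat & pform N.

Definition set_aux (N : nat) (nu : pvar N -> int) (k : nat) (z : int) :
    pvar N -> int :=
  fun v => match v with
           | Aux j => if j == k then z else nu v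
           | _ => nu v
           end.

Fixpoint pterm_val (N : nat) (nu : pvar N -> int) (t : pterm N) : int :=
  match t with
  | PVar v => nu v
  | PConst c => c
  | PAdd t1 t2 => pterm_val nu t1 + pterm_val nu t2
  | PScale c t1 => c * pterm_val nu t1
  end.

Fixpoint sat (N : nat) (nu : pvar N -> int) (f : pform N) : Prop :=
  match f with
  | PLe t1 t2 => pterm_val nu t1 <= pterm_val nu t2
  | PEq t1 t2 => pterm_val nu t1 = pterm_val nu t2
  | PNot g => ~ sat nu g
  | PAnd g h => sat nu g /\ sat nu h
  | POr g h => sat nu g \/ sat nu h
  | PEx k g => exists z : int, sat (set_aux nu k z) g
  | PAll k g => forall z : int, sat (set_aux nu k z) g
  end.

Fixpoint quantifier_free (N : nat) (f : pform N) : bool :=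
  match f with
  | PLe _ _ | PEq _ _ => true
  | PNot g => quantifier_free g
  | PAnd g h | POr g h => quantifier_free g && quantifier_free h
  | PEx _ _ | PAll _ _ => false
  end.

(* Prenex: a block of existential quantifiers, then a quantifier-free matrix. *)
Fixpoint existential (N : nat) (f : pform N) : bool :=
  match f with
  | PEx _ g => existential g
  | _ => quantifier_free f
  end.

Fixpoint pterm_scoped (N : nat) (bound : seq nat) (t : pterm N) : bool :=
  match t with
  | PVar (Aux k) => k \in bound
  | PVar _ | PConst _ => true
  | PAdd t1 t2 => pterm_scoped bound t1 && pterm_scoped bound t2
  | PScale _ t1 => pterm_scoped bound t1
  end.

(* [scoped [::] f] says that the free variables of f are among n, x, x'. *)
Fixpoint scoped (N : nat) (bound : seq nat) (f : pform N) : bool :=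
  match f with
  | PLe t1 t2 | PEq t1 t2 => pterm_scoped bound t1 && pterm_scoped bound t2
  | PNot g => scoped bound g
  | PAnd g h | POr g h => scoped bound g && scoped bound h
  | PEx k g | PAll k g => scoped (k :: bound) g
  end.

(* The value given to [Aux] is irrelevant for formulas that are [scoped]. *)
Definition valuation (N : nat) (m : int) (x x' : state N) (v : pvar N) : int :=
  match v with
  | Iter => m
  | Sys u => dvar_val x x' u
  | Aux _ => 0
  end.

Definition closed_form (N : nat) (R : dbc N) (f : pform N) : Prop :=
  scoped [::] f /\
  forall (m : nat) (x x' : state N), (0 < m)%N ->
    (sat (valuation m%:Z x x') f <-> rel_pow (dbc_rel R) m x x').

(* Little-endian binary digits, without leading zeros. *)
Fixpoint pos_bits (p : positive) : seq bool :=
  match p with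
  | xH => [:: true]
  | xO q => false :: pos_bits q
  | xI q => true :: pos_bits q
  end.

Definition nat_bits (n : nat) : seq bool :=
  match bin_of_nat n with N0 => [::] | Npos p => pos_bits p end.

(* All encodings below are self-delimiting, so that juxtaposition is
   unambiguous: each digit is announced by a 1 and a 0 ends the number. *)
Definition enc_nat (n : nat) : seq bool :=
  flatten [seq [:: true; b] | b <- nat_bits n] ++ [:: false].

Definition enc_int (z : int) : seq bool := (z < 0) :: enc_nat `|z|%N.

Definition enc_dvar (N : nat) (v : dvar N) : seq bool :=
  match v with
  | Cur i => false :: enc_nat i
  | Nxt i => true :: enc_nat i
  end.

Definition enc_datom (N : nat) (a : datom N) : seq bool :=
  enc_dvar (d_pos a) ++ enc_dvar (d_neg a) ++ enc_int (d_bound a).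

(* N itself is not part of the encoding: the size of a constraint is that of
   its atoms, whatever the number of variables that do not occur in it. *)
Definition enc_dbc (N : nat) (R : dbc N) : seq bool :=
  flatten [seq true :: enc_datom a | a <- R] ++ [:: false].

Definition enc_pvar (N : nat) (v : pvar N) : seq bool :=
  match v with
  | Iter => [:: false; false]
  | Sys u => [:: false; true] ++ enc_dvar u
  | Aux k => [:: true] ++ enc_nat k
  end.

(* Terms and formulas are written in prefix notation. *)
Fixpoint enc_pterm (N : nat) (t : pterm N) : seq bool :=
  match t with
  | PVar v => [:: false; false] ++ enc_pvar v
  | PConst c => [:: false; true] ++ enc_int c
  | PAdd t1 t2 => [:: true; false] ++ enc_pterm t1 ++ enc_pterm t2
  | PScale c t1 => [:: true; true] ++ enc_int c ++ enc_pterm t1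
  end.

Fixpoint enc_pform (N : nat) (f : pform N) : seq bool :=
  match f with
  | PLe t1 t2 => [:: false; false; false] ++ enc_pterm t1 ++ enc_pterm t2
  | PEq t1 t2 => [:: false; false; true] ++ enc_pterm t1 ++ enc_pterm t2
  | PNot g => [:: false; true; false] ++ enc_pform g
  | PAnd g h => [:: false; true; true] ++ enc_pform g ++ enc_pform h
  | POr g h => [:: true; false; false] ++ enc_pform g ++ enc_pform h
  | PEx k g => [:: true; false; true] ++ enc_nat k ++ enc_pform g
  | PAll k g => [:: true; true; false] ++ enc_nat k ++ enc_pform g
  end.

Lemma pos_bits_neq0 p : pos_bits p != [::].
Proof. by case: p. Qed.

Lemma pos_bits_inj : injective pos_bits.
Proof.
elim=> [p IH|p IH|] [q|q|] //= [E]; rewrite ?(IH _ E) //.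
- by have := pos_bits_neq0 p; rewrite E.
- by have := pos_bits_neq0 q; rewrite -E.
Qed.

Lemma nat_bits_inj : injective nat_bits.
Proof.
move=> m n E; apply: (can_inj bin_of_natK); move: E; rewrite /nat_bits.
case: (bin_of_nat m) => [|p]; case: (bin_of_nat n) => [|q] //= E.
- by have := pos_bits_neq0 q; rewrite -E.
- by have := pos_bits_neq0 p; rewrite E.
- by rewrite (pos_bits_inj E).
Qed.

Lemma enc_nat_inj m n s t :
  enc_nat m ++ s = enc_nat n ++ t -> m = n /\ s = t.
Proof.
move=> E; suff [/nat_bits_inj -> ->] : nat_bits m = nat_bits n /\ s = t by [].
move: E; rewrite /enc_nat; move: (nat_bits m) (nat_bits n).
elim=> [|b u IH] [|c v] //=; first by case.
by case=> -> /IH [-> ->].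
Qed.

Lemma enc_int_inj y z s t :
  enc_int y ++ s = enc_int z ++ t -> y = z /\ s = t.
Proof.
rewrite /enc_int /= => -[sg /enc_nat_inj [E ->]]; split=> //.
have abs (u : int) : u = (-1) ^+ (u < 0)%R * `|u|%N%:Z.
  by rewrite abszE -numEsign.
by rewrite (abs y) (abs z) sg E.
Qed.

Lemma enc_dvar_inj (N : nat) (u v : dvar N) s t :
  enc_dvar u ++ s = enc_dvar v ++ t -> u = v /\ s = t.
Proof.
by case: u => i; case: v => j //= [] /enc_nat_inj [/val_inj -> ->].
Qed.

Lemma enc_dbc_inj (N : nat) : injective (@enc_dbc N).
Proof.
rewrite /enc_dbc; elim=> [|[u v c] R IH] [|[u' v' c'] R'] //= [].
rewrite /enc_datom /= -!catA => /enc_dvar_inj [-> /enc_dvar_inj [->]].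
by move=> /enc_int_inj [-> /IH ->].
Qed.

Lemma enc_pvar_inj (N : nat) (u v : pvar N) s t :
  enc_pvar u ++ s = enc_pvar v ++ t -> u = v /\ s = t.
Proof.
case: u => [|u|k]; case: v => [|v|l] //= [].
- by move=> ->.
- by move=> /enc_dvar_inj [-> ->].
- by move=> /enc_nat_inj [-> ->].
Qed.

Lemma enc_pterm_inj (N : nat) (t u : pterm N) r s :
  enc_pterm t ++ r = enc_pterm u ++ s -> t = u /\ r = s.
Proof.
elim: t u r s => [v|c|t1 IH1 t2 IH2|c t1 IH1] [v'|c'|u1 u2|c' u1] r s //= [];
  rewrite -?(catA (enc_nat _)) -?(catA (enc_pterm _)).
- by move=> /enc_pvar_inj [-> ->].
- move=> sg E; case: (@enc_int_inj c c' r s) => [|-> ->] //.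
  by rewrite /= sg -?(catA (enc_nat _)) E.
- by move=> /IH1 [-> /IH2 [-> ->]].
- move=> sg E; case: (@enc_int_inj c c' (enc_pterm t1 ++ r) (enc_pterm u1 ++ s)).
    by rewrite /= sg -?(catA (enc_nat _)) E.
  by move=> -> /IH1 [-> ->].
Qed.

Lemma enc_pform_prefix (N : nat) (f g : pform N) r s :
  enc_pform f ++ r = enc_pform g ++ s -> f = g /\ r = s.
Proof.
elim: f g r s => [t1 t2|t1 t2|f IH|f1 IH1 f2 IH2|f1 IH1 f2 IH2|k f IH|k f IH]
  [u1 u2|u1 u2|g|g1 g2|g1 g2|l g|l g] r s //= [];
  rewrite -?(catA (enc_nat _)) -?(catA (enc_pterm _)) -?(catA (enc_pform _)).
- by move=> /enc_pterm_inj [-> /enc_pterm_inj [-> ->]].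
- by move=> /enc_pterm_inj [-> /enc_pterm_inj [-> ->]].
- by move=> /IH [-> ->].
- by move=> /IH1 [-> /IH2 [-> ->]].
- by move=> /IH1 [-> /IH2 [-> ->]].
- by move=> /enc_nat_inj [-> /IH [-> ->]].
- by move=> /enc_nat_inj [-> /IH [-> ->]].
Qed.

Lemma enc_pform_inj (N : nat) : injective (@enc_pform N).
Proof.
by move=> f g E; case: (@enc_pform_prefix N f g [::] [::]); rewrite ?E.
Qed.

(* Tape symbols are the bits and the blank [None]. *)
Notation symbol := (option bool).

Inductive move : Type := MoveLeft | Stay | MoveRight.

(* The machine has [tm_extra.+1] tapes; tape 0 is the input and output tape.
   The transition function has a finite domain, hence is a finite table. *)
Record turing_machine : Type := TuringMachine {
  tm_extra : nat;
  tm_state : finType;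
  tm_start : tm_state;
  tm_halting : pred tm_state;
  tm_trans : tm_state -> {ffun 'I_tm_extra.+1 -> symbol} ->
             tm_state * ('I_tm_extra.+1 -> symbol * move)
}.

(* A two-way infinite tape: the cells left of the head (nearest first), the
   scanned cell, and the cells right of the head; all other cells are blank. *)
Record tape : Type := Tape {
  tape_left : seq symbol;
  tape_head : symbol;
  tape_right : seq symbol
}.

Definition write_move (t : tape) (a : symbol * move) : tape :=
  let: Tape l _ r := t in
  match a.2 with
  | MoveLeft => Tape (behead l) (head None l) (a.1 :: r)
  | Stay => Tape l a.1 r
  | MoveRight => Tape (a.1 :: l) (head None r) (behead r)
  end.

(* The head scans the first symbol of the word. *)
Definition tape_of_word (w : seq bool) : tape :=
  Tape [::] (head None (map Some w)) (behead (map Some w)).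

Fixpoint word_until_blank (s : seq symbol) : seq bool :=
  match s with
  | Some b :: s' => b :: word_until_blank s'
  | _ => [::]
  end.

(* The word read from the head rightwards up to the first blank. *)
Definition word_of_tape (t : tape) : seq bool :=
  word_until_blank (tape_head t :: tape_right t).

Record config (M : turing_machine) : Type := Config {
  cf_state : tm_state M;
  cf_tapes : 'I_(tm_extra M).+1 -> tape
}.

Definition init_config (M : turing_machine) (w : seq bool) : config M :=
  Config (tm_start M)
    (fun i => if i == ord0 then tape_of_word w else tape_of_word [::]).

(* Halted configurations are left unchanged. *)
Definition tm_step (M : turing_machine) (c : config M) : config M :=
  if tm_halting (cf_state c) then c else
  let: (q, act) :=
    tm_trans (cf_state c) [ffun i => tape_head (cf_tapes c i)] in
  Config q (fun i => write_move (cf_tapes c i) (act i)).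

(* On input w, M halts after at most T steps with output w'. *)
Definition outputs_within (M : turing_machine) (w w' : seq bool) (T : nat) :
    Prop :=
  let c := iter T (@tm_step M) (init_config M w) in
  tm_halting (cf_state c) /\ word_of_tape (cf_tapes c ord0) = w'.

(* Main.v *)
Require Import Defs.
From Corelib Require Import BinNums.
From Stdlib Require Import Classical ClassicalEpsilon ClassicalChoice.
From Stdlib Require Import FunctionalExtensionality.
From HB Require Import structures.
From mathcomp Require Import all_boot all_order all_algebra.
From mathcomp Require Import zify ring lra.
Set Implicit Arguments.
Unset Strict Implicit.
Unset Printing Implicit Defensive.

Import Order.TTheory GRing.Theory Num.Theory.
Local Open Scope ring_scope.

(* In both directions R says that y (src e) <= y' (dst e) + wt e for every edge
   e of a weighted graph on the variables (y, y' are the values at the positive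
   and negative ends of the atoms), so R^n says that y u <= y' z + w for every
   walk of length n and weight w from u to z. With d the number of ends of
   edges, each walk of length at least d can be replaced by one of the same
   length, no heavier, of the form al lam^k be where lam is a cycle of minimal
   mean weight with |lam| <= d, and |al|, |be| <= d^2: among d |lam| + 1
   positions two agree in their vertex and modulo |lam|, and the closed walk
   between them is traded for turns of lam.

   The formula guesses, for each cycle length l and each pivot v, a number K of
   turns and a remainder r with n = l K + r, a potential Y for the first steps
   from y, a potential U for one turn with weights multiplied by K (so that
   [c * K] is the only product), and a potential Z that continues from
   Y(t, v) + U(l, v) and ends below y' at time r. No finiteness flag is needed:
   unreachable vertices get a very negative potential.

   The auxiliary variables are named by words that contain the tuple they
   depend on, so all blocks of the formula are instances of one template and
   the formula is written by nested loops over the bits and the atoms of the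
   input. The loops are a program over stacks, one for each tape of the
   machine. *)

(** * Minimal walks of a given length *)

Section Walks.
Variables (V : eqType) (E : seq (V * V * int)).

Definition src (e : V * V * int) := e.1.1.
Definition dst (e : V * V * int) := e.1.2.
Definition wt (e : V * V * int) := e.2.

Fixpoint walk (u : V) (p : seq (V * V * int)) (z : V) : bool :=
  if p is e :: q then [&& e \in E, src e == u & walk (dst e) q z] else u == z.

Definition weight (p : seq (V * V * int)) : int := \sum_(e <- p) wt e.

Definition endpoint (u : V) (p : seq (V * V * int)) : V := last u (map dst p).

Lemma weight_cat p q : weight (p ++ q) = weight p + weight q.
Proof. exact: big_cat. Qed.

Lemma walk_endpoint u p z : walk u p z -> endpoint u p = z.
Proof.
by elim: p u => [|e p IH] u /= => [/eqP //|/and3P[_ _ /IH]].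
Qed.

Lemma walk_cat u p q z :
  walk u (p ++ q) z = walk u p (endpoint u p) && walk (endpoint u p) q z.
Proof.
elim: p u => [|e p IH] u /=; first by rewrite eqxx.
by rewrite IH -!andbA /endpoint.
Qed.

Lemma walk_comp u p v q z : walk u p v -> walk v q z -> walk u (p ++ q) z.
Proof. by move=> Hp Hq; rewrite walk_cat (walk_endpoint Hp) Hp Hq. Qed.

Lemma walk_sub u p z : walk u p z -> {subset p <= E}.
Proof.
elim: p u => [|e p IH] u //= /and3P[He _ /IH Hp] x.
by rewrite inE => /predU1P[->|/Hp].
Qed.

(** In [u :: map dst p] the entry [t] is the vertex reached after [t] edges; positions on a walk are
    addressed in this way from here on. *)
Lemma walk_split u p z (t : nat) : (t <= size p)%N -> walk u p z ->
  let x := nth u (u :: map dst p) t in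
  walk u (take t p) x /\ walk x (drop t p) z.
Proof.
move=> le_tp; rewrite -{1}(cat_take_drop t p) walk_cat => /andP[].
suff -> : endpoint u (take t p) = nth u (u :: map dst p) t by [].
rewrite /endpoint (last_nth u) size_map size_takel //.
by case: t le_tp => //= t le_tp; rewrite map_take nth_take.
Qed.

(** Counted with repetitions, which gives the bound [2 * size E] on the relevant vertices. The
    number of all variables cannot serve, since it does not enter the size of the input. *)
Definition nodes : seq V := map src E ++ map dst E.

Lemma size_nodes : size nodes = (2 * size E)%N.
Proof. by rewrite size_cat !size_map mul2n addnn. Qed.

Lemma walk_nodes u p z : walk u p z -> {subset map dst p <= nodes}.
Proof.
move=> /walk_sub Hp x /mapP[e /Hp He ->].
by rewrite mem_cat; apply/orP; right; apply: map_f.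
Qed.

Lemma src_nodes u p z : (0 < size p)%N -> walk u p z -> u \in nodes.
Proof.
case: p => //= e p _ /and3P[He /eqP <- _].
by rewrite mem_cat map_f.
Qed.

Lemma pigeonhole (C : eqType) (g : nat -> C) (cs : seq C) (n : nat) :
  (forall t, (t <= n)%N -> g t \in cs) -> (size cs <= n)%N ->
  exists t t', [/\ (t < t')%N, (t' <= n)%N & g t = g t'].
Proof.
move=> Hg Hn; pose s := [seq g t | t <- iota 0 n.+1].
have sz : size s = n.+1 by rewrite size_map size_iota.
have /(uniqPn (g 0%N)) [t [t' []]] : ~~ uniq s.
  apply/negP => Us; have := uniq_leq_size (s2 := cs) Us.
  rewrite sz => H; suff: (n.+1 <= size cs)%N by lia.
  apply: H => x /mapP[t]; rewrite mem_iota => Ht ->; apply: Hg; lia.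
rewrite sz => tt' t'n; rewrite !(nth_map 0%N) ?size_iota ?nth_iota; try lia.
by exists t, t'; split.
Qed.

Lemma split3 (p : seq (V * V * int)) t t' : (t <= t')%N ->
  p = take t p ++ take (t' - t) (drop t p) ++ drop t' p.
Proof.
move=> le; rewrite -{1}(cat_take_drop t p); congr (_ ++ _).
by rewrite -{1}(cat_take_drop (t' - t) (drop t p)) drop_drop subnK.
Qed.

Lemma walk_cycle u p z (t t' : nat) : (t < t')%N -> (t' <= size p)%N ->
  walk u p z -> nth u (u :: map dst p) t = nth u (u :: map dst p) t' ->
  exists x p1 c p2, [/\ p = p1 ++ c ++ p2, walk u p1 x, walk x c x,
    walk x p2 z & [/\ size p1 = t, size c = t' - t
    & x = nth u (u :: map dst p) t]]%N.
Proof.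
move=> tt' t'p Hw Ett'.
have [H1 _] := walk_split (ltnW (leq_trans tt' t'p)) Hw.
have [H2 H3] := walk_split t'p Hw.
exists (nth u (u :: map dst p) t), (take t p), (take (t' - t) (drop t p)),
  (drop t' p); split=> //.
- exact: split3 (ltnW tt').
- move: H2; rewrite -Ett' -{1}(subnKC (ltnW tt')) takeD walk_cat.
  by rewrite (walk_endpoint H1) => /andP[].
- by rewrite Ett'.
- by rewrite !size_takel ?size_drop //; lia.
Qed.

(** Descent on the distance to the lower bound [b]. This yields a minimum over cycles without
    enumerating them. *)
Lemma int_minimizer (A : Type) (P : A -> Prop) (f : A -> int) (b : int) :
  (exists x, P x) -> (forall x, P x -> b <= f x) ->
  exists2 x, P x & forall y, P y -> f x <= f y.
Proof.
move=> [x0 Px0] Hb.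
suff H n : forall x, P x -> (f x - b <= n%:Z) ->
    exists2 x, P x & forall y, P y -> f x <= f y.
  by apply: (H `|f x0 - b|%N x0 Px0); have := Hb _ Px0; lia.
elim: n => [|n IH] x Px Hx.
  by exists x => // y Py; have := Hb _ Px; have := Hb _ Py; lia.
case: (classic (exists2 y, P y & f y < f x)) => [[y Py Hy]|H].
  by apply: (IH y Py); lia.
by exists x => // y Py; case: (leP (f x) (f y)) => // Hyx; case: H; exists y.
Qed.

Definition absweight : int := \sum_(e <- E) `|wt e|.

Lemma absweight_ge0 : 0 <= absweight.
Proof. by apply: sumr_ge0. Qed.

Lemma wt_absweight e : e \in E -> `|wt e| <= absweight.
Proof.
rewrite /absweight; elim: E => // f F IH; rewrite inE big_cons => /predU1P[->|].
  by rewrite lerDl; apply: sumr_ge0.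
by move=> /IH H; apply: le_trans H _; rewrite lerDr.
Qed.

Lemma weight_bound u p z : walk u p z -> `|weight p| <= (size p)%:Z * absweight.
Proof.
elim: p u => [|e p IH] u /=; first by rewrite /weight big_nil mul0r.
move=> /and3P[/wt_absweight He _ /IH Hp].
rewrite /weight big_cons -/(weight p) intS mulrDl mul1r.
by apply: le_trans (ler_normD _ _) _; apply: lerD.
Qed.

(** Only targets are tested: for a closed nonempty walk they include the starting vertex. Cycles are
    later confined to the vertices of a given walk, so that this walk meets them. *)
Definition inside (S : seq V) (p : seq (V * V * int)) : bool :=
  all (mem S) (map dst p).

(* [d`!] clears the denominators of the mean weights of cycles of length at
   most d, which makes them comparable as integers. *)
Lemma min_mean_cycle (S : seq V) (d : nat) :
  (exists x c, [/\ walk x c x, inside S c & 0 < size c <= d]%N) ->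
  exists x lam, [/\ walk x lam x, inside S lam, (0 < size lam <= d)%N &
    forall y c, walk y c y -> inside S c -> (0 < size c <= d)%N ->
      weight lam * (size c)%:Z <= weight c * (size lam)%:Z].
Proof.
move=> [x0 [c0 [W0 I0 L0]]].
pose P (xc : V * seq (V * V * int)) := [/\ walk xc.1 xc.2 xc.1, inside S xc.2
   & (0 < size xc.2 <= d)%N].
pose f (xc : V * seq (V * V * int)) : int :=
  weight xc.2 * (d`! %/ size xc.2)%N%:Z.
have fE xc : P xc -> f xc * (size xc.2)%:Z = weight xc.2 * (d`!)%:Z.
  move=> [_ _ L]; rewrite /f -mulrA -PoszM divnK //.
  by apply: dvdn_fact.
case: (@int_minimizer _ P f (- (absweight * d%:Z * (d`!)%:Z))).
- by exists (x0, c0).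
- move=> [x c] [/= Wc Ic Lc]; rewrite /f /=.
  have := weight_bound Wc.
  have h1 : ((d`! %/ size c)%N%:Z <= (d`!)%:Z)%R by rewrite lez_nat leq_div.
  have h2 : (0 <= (d`! %/ size c)%N%:Z)%R by [].
  move: (d`! %/ size c)%N%:Z h1 h2 => q h1 h2 h3.
  have h4 : (size c)%:Z <= d%:Z by rewrite lez_nat; lia.
  have h5 := absweight_ge0.
  have h6 : (size c)%:Z * absweight <= absweight * d%:Z.
    by rewrite mulrC; apply: ler_wpM2l.
  have h7 : - (absweight * d%:Z) <= weight c by lia.
  have h8 : 0 <= absweight * d%:Z by apply: mulr_ge0.
  by nia.
move=> [x lam] Pl Hmin; exists x, lam; case: (Pl) => /= W I L; split=> // y c Wc Ic Lc.
have Pc : P (y, c) by [].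
have fac : (0 < (d`!)%:Z)%R by rewrite ltz_nat fact_gt0.
have /= e1 := fE _ Pl; have /= e2 := fE _ Pc.
rewrite -(ler_pM2r fac) mulrAC -e1 [leRHS]mulrAC -e2 [leRHS]mulrAC.
by rewrite !ler_wpM2r //; apply: Hmin Pc.
Qed.

Lemma endpoint_inside (S : seq V) x c :
  walk x c x -> (0 < size c)%N -> inside S c -> x \in S.
Proof.
move=> /walk_endpoint; case: c => // e c <- _ I.
by have /= := allP I (last (dst e) (map dst c)) (mem_last _ _).
Qed.

(** Among the first [d + 1] positions two carry the same vertex. The part between them is short, and
    what is left after cutting it out is still closed. *)
Lemma short_cycle (S : seq V) d x c : (size nodes <= d)%N ->
  walk x c x -> inside S c -> (d < size c)%N ->
  exists y p1 c' p2, [/\ c = p1 ++ c' ++ p2, walk y c' y,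
    walk x (p1 ++ p2) x & (0 < size c' <= d)%N].
Proof.
move=> Hd W I L.
have Hin t : (t <= d)%N -> nth x (x :: map dst c) t \in nodes.
  move=> Ht; have : nth x (x :: map dst c) t \in x :: map dst c.
    by apply: mem_nth; rewrite /= size_map; lia.
  rewrite inE => /predU1P[->|]; last exact: walk_nodes W _.
  by apply: src_nodes W; lia.
have [t [t' [tt' t'd Ett']]] := pigeonhole Hin Hd.
have [|y [p1 [c' [p2 [Ec W1 W2 W3 [S1 S2 _]]]]]] := walk_cycle tt' _ W Ett'.
  by lia.
exists y, p1, c', p2; split=> //; first exact: walk_comp W1 W3.
by rewrite S2; lia.
Qed.

(** Induction on the length: a long closed walk splits into a short cycle and a shorter closed walk,
    and the inequality is additive in weight and length. *)
Lemma mean_of_cycle (S : seq V) d lam : (size nodes <= d)%N ->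
  (forall y c, walk y c y -> inside S c -> (0 < size c <= d)%N ->
      weight lam * (size c)%:Z <= weight c * (size lam)%:Z) ->
  forall y c, walk y c y -> inside S c ->
      weight lam * (size c)%:Z <= weight c * (size lam)%:Z.
Proof.
move=> Hd Hmin y c; have [n] := ubnP (size c).
elim: n y c => // n IH y c lt_cn W I.
have [c0|c0] := posnP (size c).
  by move: (size0nil c0) => ->; rewrite /weight big_nil mul0r mulr0.
case: (leqP (size c) d) => Lc; first by apply: (Hmin _ _ W I); rewrite c0.
have [x [p1 [c' [p2 [Ec W1 W2 /andP[L1 L2]]]]]] := short_cycle Hd W I Lc.
have /and3P[I1 I2 I3] : [&& inside S p1, inside S c' & inside S p2].
  by move: I; rewrite Ec /inside !map_cat !all_cat.
have sc : size c = (size c' + size (p1 ++ p2))%N by rewrite Ec !size_cat; lia.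
have wc : weight c = weight c' + weight (p1 ++ p2).
  by rewrite Ec !weight_cat; lia.
have := Hmin _ _ W1 I2; rewrite L1 L2 => /(_ isT) h1.
have h2 := IH _ (p1 ++ p2) _ W2.
rewrite sc wc PoszD mulrDr mulrDl; apply: lerD => //.
by apply: h2; [lia | rewrite /inside map_cat all_cat; apply/andP].
Qed.

(** Vertex and residue modulo [size lam] take at most [size nodes * size lam] values, so a walk with
    that many edges contains a closed walk whose length is a multiple of [size lam]. By minimality
    of the mean, the latter weighs at least as much as the turns of [lam] it is traded for. The
    turns are only counted in [q]: [p'] need not meet [lam]. *)
Lemma reduce_walk (S : seq V) lam : (0 < size lam)%N -> {subset S <= nodes} ->
  (forall y c, walk y c y -> inside S c ->
      weight lam * (size c)%:Z <= weight c * (size lam)%:Z) ->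
  forall u p v, u \in S -> walk u p v -> inside S p ->
  exists p' q, [/\ walk u p' v, (size p' < size nodes * size lam + 1)%N,
    size p = (size p' + q * size lam)%N &
    weight p' + q%:Z * weight lam <= weight p].
Proof.
move=> l0 Snodes Hmean u p v Su; have [n] := ubnP (size p).
elim: n p => // n IH p lt_pn W I.
case: (ltnP (size p) (size nodes * size lam)) => Lp.
  by exists p, 0%N; split=> //; [lia|lia|rewrite mul0r addr0].
have [||t [t' [tt' t'd [Ett' Emod]]]] :=
  @pigeonhole _ (fun t => (nth u (u :: map dst p) t, t %% size lam)%N)
   [seq (x, y) | x <- nodes, y <- iota 0 (size lam)] (size p).
- move=> t Ht; apply: allpairs_f; last by rewrite mem_iota /= add0n ltn_mod.
  apply: Snodes; have : nth u (u :: map dst p) t \in u :: map dst p.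
    by apply: mem_nth; rewrite /= size_map; lia.
  by rewrite inE => /predU1P[-> //|]; move/allP: I; apply.
- by rewrite size_allpairs size_iota.
have [y [p1 [c [p2 [Ec W1 W2 W3 [S1 S2 _]]]]]] := walk_cycle tt' t'd W Ett'.
have /and3P[I1 I2 I3] : [&& inside S p1, inside S c & inside S p2].
  by move: I; rewrite Ec /inside !map_cat !all_cat.
have [q Eq] : exists q, size c = (q * size lam)%N.
  have : (size lam %| t' - t)%N by rewrite -eqn_mod_dvd ?(ltnW tt') // Emod.
  by rewrite -S2 => /dvdnP.
have c0 : (0 < size c)%N by rewrite S2 subn_gt0.
clear Emod Lp Ett' S1 S2 tt' t'd.
have [||p' [q' [Wp' Sp' Ep' Hp']]] := IH (p1 ++ p2) _ (walk_comp W1 W3).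
- apply: (@leq_trans (size p)) => //; rewrite Ec !size_cat ltn_add2l.
  by rewrite -[X in (X < _)%N]add0n ltn_add2r.
- by rewrite /inside map_cat all_cat; apply/andP.
exists p', (q + q')%N; split=> //.
  have -> : size p = (size (p1 ++ p2) + size c)%N by rewrite Ec !size_cat; ring.
  by rewrite Ep' mulnDl -Eq; ring.
have := Hmean _ _ W2 I2; rewrite Eq PoszM mulrA ler_pM2r ?ltz_nat //.
move: Hp'; rewrite Ec !weight_cat PoszD mulrDl mulrC; clear; lia.
Qed.

(** A walk with [d] edges repeats a vertex, so some cycle stays within its vertex set [S]. The best
    such cycle passes through a vertex [v] of the walk; the parts before and after [v] are reduced
    separately, and the turns saved in both are all made at [v]. *)
Lemma path_scheme d u p z : (size nodes <= d)%N -> walk u p z -> (d <= size p)%N ->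
  (0 < size p)%N ->
  exists v lam al be k,
  [/\ walk v lam v, walk u al v, walk v be z, (0 < size lam <= d)%N &
   [/\ (size al <= d * d)%N, (size be <= d * d)%N,
     size p = (size al + k * size lam + size be)%N &
     weight al + k%:Z * weight lam + weight be <= weight p]].
Proof.
move=> Hd W Ld L0.
pose S := u :: map dst p.
have Ssub : {subset S <= nodes}.
  by move=> x; rewrite inE => /predU1P[->|]; [apply: src_nodes W|apply: walk_nodes W _].
have Ip : inside S p by apply/allP => x Hx; rewrite /= inE Hx orbT.
have Su : u \in S by rewrite mem_head.
have Hin t : (t <= d)%N -> nth u S t \in nodes.
  by move=> Ht; apply/Ssub/mem_nth; rewrite /= size_map; lia.
have [t [t' [tt' t'd Ett']]] := pigeonhole Hin Hd.
have [|x0 [p1 [c [p2 [Ec W1 W2 W3 [S1 S2 _]]]]]] := walk_cycle tt' _ W Ett'.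
  by lia.
have [|v [lam [Wl Il Ll Hmin]]] := @min_mean_cycle S d.
  exists x0, c; split=> //; last by lia.
  by move: Ip; rewrite Ec /inside !map_cat !all_cat => /and3P[].
have Hmean := mean_of_cycle Hd Hmin.
have /andP[l0 _] := Ll.
have Sv : v \in S by apply: endpoint_inside Wl l0 Il.
have [Wa Wb] : walk u (take (index v S) p) v /\ walk v (drop (index v S) p) z.
  have := @walk_split _ _ _ (index v S) _ W.
  rewrite -/S nth_index //; apply.
  by rewrite -ltnS; move: Sv; rewrite -index_mem /S [X in (_ < X)%N]/= size_map.
move: Ip; rewrite -{1}(cat_take_drop (index v S) p) /inside map_cat all_cat.
case/andP=> Ia Ib.
have [al [qa [Wal Sal Eal Hal]]] := reduce_walk l0 Ssub Hmean Su Wa Ia.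
have [be [qb [Wbe Sbe Ebe Hbe]]] := reduce_walk l0 Ssub Hmean Sv Wb Ib.
exists v, lam, al, be, (qa + qb)%N; split=> //.
have bnd : (size nodes * size lam <= d * d)%N by apply: leq_mul => //; case/andP: Ll.
split.
- by apply: leq_trans bnd; move: Sal; rewrite addn1.
- by apply: leq_trans bnd; move: Sbe; rewrite addn1.
- by rewrite -{1}(cat_take_drop (index v S) p) size_cat Eal Ebe mulnDl; ring.
- rewrite -[X in _ <= weight X](cat_take_drop (index v S) p) weight_cat.
  apply: le_trans (lerD Hal Hbe); rewrite PoszD mulrDl.
  by rewrite le_eqVlt; apply/orP; left; apply/eqP; ring.
Qed.

(** Longest-path recursion: the value is the maximum of [f t' u - kap * weight p] over [t' <= t] and
    walks [p] of length [t - t'] from [u] to [j]. It is the least potential above the sources [f]; a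
    very negative source plays the role of minus infinity. *)
Fixpoint traj (f : nat -> V -> int) (kap : int) (t : nat) (j : V) : int :=
  if t is t'.+1 then
    foldr Num.max (f t j)
      [seq traj f kap t' (src e) - kap * wt e | e <- E & dst e == j]
  else f 0%N j.

Lemma foldr_max_ge (x0 : int) s x : x \in x0 :: s -> x <= foldr Num.max x0 s.
Proof.
elim: s => [|y s IH] /=; first by rewrite inE => /eqP ->.
rewrite !inE orbCA => /predU1P[->|]; rewrite le_max ?lexx // => H.
by rewrite IH ?orbT // inE.
Qed.

Lemma foldr_max_in (x0 : int) s : foldr Num.max x0 s \in x0 :: s.
Proof.
elim: s => [|y s IH] /=; first exact: mem_head.
rewrite inE orbC in_cons; case: leP => _; rewrite ?eqxx //.
by move: IH; rewrite inE => /orP[->|->]; rewrite ?orbT.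
Qed.

Lemma traj_ge_source f kap t j : f t j <= traj f kap t j.
Proof. by case: t => [//|t]; apply: foldr_max_ge; apply: mem_head. Qed.

Lemma traj_step f kap t e : e \in E ->
  traj f kap t (src e) <= traj f kap t.+1 (dst e) + kap * wt e.
Proof.
move=> He; rewrite -lerBlDr; apply: foldr_max_ge; rewrite inE; apply/orP; right.
by apply/mapP; exists e => //; rewrite mem_filter eqxx.
Qed.

Lemma walk_rcons u p e : walk u (rcons p e) (dst e) = walk u p (src e) && (e \in E).
Proof.
elim: p u => [|d p IH] u /=; first by rewrite eqxx andbT andbC eq_sym.
by rewrite IH !andbA.
Qed.

(** The maximum is attained, so an upper bound on a trajectory reduces to a bound on a single
    walk. *)
Lemma traj_origin f kap t j : exists t' u p,
  [/\ (t' <= t)%N, walk u p j, size p = (t - t')%N &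
      traj f kap t j = f t' u - kap * weight p].
Proof.
have here t0 j0 : exists t' u p, [/\ (t' <= t0)%N, walk u p j0,
    size p = (t0 - t')%N & f t0 j0 = f t' u - kap * weight p].
  by exists t0, j0, [::]; rewrite /= subnn eqxx /weight big_nil mulr0 subr0.
elim: t j => [|t IH] j; first exact: here.
have /= := foldr_max_in (f t.+1 j)
  [seq traj f kap t (src e) - kap * wt e | e <- E & dst e == j].
rewrite inE => /predU1P[->|/mapP[e]]; first exact: here.
rewrite mem_filter => /andP[/eqP Ej He ->].
have [t' [u [p [t't W Sp ->]]]] := IH (src e).
exists t', u, (rcons p e); split.
- exact: leqW.
- by rewrite -Ej walk_rcons W.
- by rewrite size_rcons Sp subSn.
- by rewrite -cats1 weight_cat /(weight [:: e]) big_seq1 mulrDr opprD addrA.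
Qed.

End Walks.

Arguments src {V} e.
Arguments dst {V} e.
Arguments wt {V} e.

(** * Powers of the relation in terms of walks *)

Section Powers.
Variables (N : nat) (E : seq ('I_N * 'I_N * int)).

Definition edge_rel (y y' : state N) : Prop :=
  forall e, e \in E -> y (src e) <= y' (dst e) + wt e.

Lemma rel_pow_chain (m : nat) (X : nat -> state N) (y' : state N) :
  (forall t, (t < m)%N -> edge_rel (X t) (X t.+1)) -> edge_rel (X m) y' ->
  rel_pow edge_rel m.+1 (X 0%N) y'.
Proof.
elim: m X => [|m IH] X HX Hl; first by exists y'.
exists (X 1%N); first exact: HX.
by apply: (IH (fun t => X t.+1)) => // t Ht; apply: HX.
Qed.

Definition respects_walks (m : nat) (y y' : state N) : Prop :=
  forall u p z, walk E u p z -> size p = m -> y u <= y' z + weight p.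

Lemma state_bound (y : state N) i : `|y i| <= \sum_j `|y j|.
Proof. by rewrite (bigD1 i) //= lerDl; apply: sumr_ge0. Qed.

(** From left to right the inequalities add up along a walk. Conversely, the intermediate states are
    the trajectory started from [y]. For [m = 0] the right side would only say that [y] lies below
    [y']. *)
Lemma rel_pow_walks (m : nat) (y y' : state N) : (0 < m)%N ->
  rel_pow edge_rel m y y' <-> respects_walks m y y'.
Proof.
move=> m0; split.
  clear m0; elim: m y => [|m IH] y /=.
    by move=> -> u [|//] z /= /eqP -> _; rewrite /weight big_nil addr0.
  case=> x Hx /IH{}IH u [//|e p] z /= /and3P[He /eqP <- W] [Sp].
  have := IH _ _ _ W Sp; have := Hx _ He.
  rewrite /weight big_cons -/(weight p); lia.
case: m m0 => // m _ H.
(* The floor [- b] keeps all coordinates finite; [b] is so large that a walk of at most [m + 1]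
   edges that starts at the floor still ends below [y']. *)
pose b := (m.+1)%:Z * absweight E + \sum_j `|y' j|.
pose f t i := if t is 0 then y i else - b.
pose X t : state N := [ffun i => traj E f 1 t i].
have X0 : X 0%N = y by apply/ffunP => i; rewrite ffunE.
rewrite -X0; apply: rel_pow_chain => [t _|] e He.
  by rewrite !ffunE; have := traj_step f 1 t He; rewrite mul1r.
rewrite ffunE; have [t' [u [p [t'm W Sp ->]]]] := traj_origin E f 1 m (src e).
case: t' => [|t'] in t'm Sp *.
  have := H u (rcons p e) (dst e); rewrite walk_rcons W He size_rcons Sp subn0.
  move=> /(_ isT erefl); rewrite -cats1 weight_cat /(weight [:: e]) big_seq1 /=.
  by move=> h; rewrite mul1r lerBlDr -addrA [wt e + _]addrC.
have W' : walk E u (rcons p e) (dst e) by rewrite walk_rcons W.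
have := weight_bound W'; rewrite -cats1 weight_cat /(weight [:: e]) big_seq1 /=.
have := state_bound y' (dst e); have := absweight_ge0 E.
rewrite size_cat Sp /= mul1r /b => h1 h2 h3.
have : (m - t'.+1 + 1)%N%:Z * absweight E <= (m.+1)%:Z * absweight E.
  by apply: ler_wpM2r => //; rewrite lez_nat; lia.
move/(le_trans h3); move: (_ * absweight E) (\sum_j _) h2 => A B; clear; lia.
Qed.

End Powers.

(** * Certificates for the powers: soundness and completeness *)

Section Certificate.
Variables (N : nat) (E : seq ('I_N * 'I_N * int)).

Lemma walk_nseq v lam k : walk E v lam v -> walk E v (flatten (nseq k lam)) v.
Proof. by move=> W; elim: k => [|k IH] /=; [rewrite eqxx | apply: walk_comp W IH]. Qed.

Lemma weight_nseq (lam : seq ('I_N * 'I_N * int)) k :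
  weight (flatten (nseq k lam)) = k%:Z * weight lam.
Proof.
elim: k => [|k IH] /=; first by rewrite /weight big_nil mul0r.
by rewrite weight_cat IH intS mulrDl mul1r.
Qed.

Lemma size_nseq_flatten (T : Type) (lam : seq T) k :
  size (flatten (nseq k lam)) = (k * size lam)%N.
Proof. by rewrite size_flatten /shape map_nseq sumn_nseq mulnC. Qed.

Lemma walk_target u p z : walk E u p z -> (0 < size p)%N ->
  exists2 e, e \in E & dst e = z.
Proof.
elim: p u => [|e p IH] u //= /and3P[He _ W] _.
case: p => [|e' p] in W IH *; last exact: IH W _.
by exists e => //; apply/eqP.
Qed.

Lemma walk_source u p z : walk E u p z -> (0 < size p)%N ->
  exists2 e, e \in E & src e = u.
Proof. by case: p => //= e p /and3P[He /eqP <- _] _; exists e. Qed.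

Lemma walk_potential (T : nat) (F : nat -> 'I_N -> int) (kap : int) t0 u p z :
  (forall t e, (t < T)%N -> e \in E -> F t (src e) <= F t.+1 (dst e) + wt e * kap) ->
  walk E u p z -> (t0 + size p <= T)%N ->
  F t0 u <= F (t0 + size p)%N z + weight p * kap.
Proof.
move=> HF; elim: p u t0 => [|e p IH] u t0 /=.
  by move=> /eqP -> _; rewrite addn0 /weight big_nil mul0r addr0.
move=> /and3P[He /eqP <- W] L; have := HF t0 e; rewrite He => /(_ _ isT) h1.
have := IH _ t0.+1 W; rewrite addSnnS => /(_ L).
have := h1 _; rewrite /weight big_cons -/(weight p) mulrDl.
by move=> /(_ ltac:(lia)); move: (_ * kap) (_ * kap) (F _ _) (F _ _) (F _ _) => *; lia.
Qed.

(* [n] steps are split into [K] turns of a cycle through [v] of length [l] and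
   [r] further steps, of which those before the turns are controlled by [Y] and
   those after by [Z]; [- U l v] bounds the weight of the [K] turns. The last
   conjunct treats the small [n], for which no cycle is needed. *)
Definition block_ok (n : int) (y y' : state N) (M T l : nat) (v : 'I_N)
    (K r : int) (A : nat -> int) (Y U Z : nat -> 'I_N -> int)
    (t : nat) (e : 'I_N * 'I_N * int) : Prop :=
  [/\ [/\ 0 <= K, r + 1 <= T%:Z & n = r \/ T%:Z <= r + M%:Z],
      [/\ A 0%N = 0, A t.+1 = A t + K & n = A l + r],
      [/\ y (src e) <= Y 0%N (src e),
          Y t (src e) <= Y t.+1 (dst e) + wt e,
          U t (src e) <= U t.+1 (dst e) + wt e * K &
          Z t (src e) <= Z t.+1 (dst e) + wt e],
      (0 <= U 0%N v /\ Y t v + U l v <= Z t v) &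
      (~ r = t%:Z \/ Z t (dst e) <= y' (dst e)) /\
      (~ n = t%:Z \/ Y t (dst e) <= y' (dst e))].

Variables (M T m : nat) (y y' : state N).
(** In the end [M] is the length of the input, in which each atom takes at least seven bits. Then
    [d = 2 * size E] is at most [M], and [T] has room for two walks of [d * d] edges and [M] further
    steps. *)
Hypotheses (m_gt0 : (0 < m)%N) (M_large : (7 * size E < M)%N) (TE : T = (M * M)%N).

Let M_le_T : (M <= T)%N.
Proof. by rewrite TE; case: M M_large => // *; rewrite leq_pmulr. Qed.

(** For large [m] the walk is replaced by [al lam^k be], and the certificate for [size lam] and [v]
    is used. Its remainder is long enough for [al] and [be], so [K <= k]. The bound is then
    collected from [Y] before the [K] turns, from [U] for the turns and from [Z] after them. *)
Lemma certificate_sound :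
  (forall l v, (0 < l <= M)%N -> v \in map dst E -> exists K r A Y U Z,
     forall t e, (t < T)%N -> e \in E ->
       block_ok m%:Z y y' M T l v K r A Y U Z t e) ->
  respects_walks E m y y'.
Proof.
move=> H u p z W Sp; have p0 : (0 < size p)%N by rewrite Sp.
have T0 : (0 < T)%N by apply: leq_trans M_le_T; apply: leq_ltn_trans M_large.
have [ez Ez Dz] := walk_target W p0; have [eu Eu Du] := walk_source W p0.
case: (ltnP m T) => mT.
  (* For [m < T] the potential [Y] suffices, and any length and pivot in range provide one. *)
  have l1 : (0 < 1 <= M)%N by apply: leq_ltn_trans M_large.
  have [K [r [A [Y [U [Z HB]]]]]] := H 1%N (dst ez) l1 (map_f _ Ez).
  have [_ _ [h1 _ _ _] _ _] := HB _ _ T0 Eu.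
  have [_ _ _ _ [_ [//|h2]]] := HB _ _ mT Ez.
  have HY t e : (t < T)%N -> e \in E -> Y t (src e) <= Y t.+1 (dst e) + wt e * 1.
    by move=> tT He; have [_ _ [_ h _ _] _ _] := HB _ _ tT He; rewrite mulr1.
  have := walk_potential (t0 := 0%N) HY W; rewrite add0n Sp mulr1 => /(_ (ltnW mT)).
  by rewrite Du in h1; rewrite Dz in h2; lia.
pose d := (2 * size E)%N.
have ddT : (d * d + d * d + M <= T)%N.
  rewrite TE /d; move: M (size E) M_large; clear; nia.
have Lm : (d <= size p)%N.
  by rewrite Sp; apply: leq_trans mT; apply: leq_trans M_le_T; rewrite /d; lia.
have Hd : (size (nodes E) <= d)%N by rewrite size_nodes.
have [v [lam [al [be [k [Wl Wal Wbe /andP[l0 ld] [Sal Sbe Ep Hw]]]]]]] :=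
  path_scheme Hd W Lm p0.
have lM : (0 < size lam <= M)%N.
  by rewrite l0; apply: leq_trans ld _; rewrite /d; lia.
have [ev Ev Dv] := walk_target Wl l0.
have vE : v \in map dst E by rewrite -Dv map_f.
have [K [r [A [Y [U [Z HB]]]]]] := H _ _ lM vE.
have [[K0 rT rM] [A0 _ nA] [h1 _ _ _] [U0 _] _] := HB _ _ T0 Eu.
have AE t : (t <= T)%N -> A t = t%:Z * K.
  elim: t => [|t IH] tT; first by rewrite A0 mul0r.
  have [_ [_ -> _] _ _ _] := HB _ _ tT Eu.
  by rewrite IH ?(ltnW tT) // intS mulrDl mul1r addrC.
rewrite AE in nA; last by case/andP: lM => _ /leq_trans; apply.
have HY t e : (t < T)%N -> e \in E -> Y t (src e) <= Y t.+1 (dst e) + wt e * 1.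
  by move=> tT He; have [_ _ [_ h _ _] _ _] := HB _ _ tT He; rewrite mulr1.
have HU t e : (t < T)%N -> e \in E -> U t (src e) <= U t.+1 (dst e) + wt e * K.
  by move=> tT He; have [_ _ [_ _ h _] _ _] := HB _ _ tT He.
have HZ t e : (t < T)%N -> e \in E -> Z t (src e) <= Z t.+1 (dst e) + wt e * 1.
  by move=> tT He; have [_ _ [_ _ _ h] _ _] := HB _ _ tT He; rewrite mulr1.
have rM' : T%:Z <= r + M%:Z by case: rM => // Er; move: rT mT; rewrite -Er; lia.
have [Kn EK] : exists Kn : nat, K = Kn%:Z by exists `|K|%N; lia.
have [rn Er] : exists rn : nat, r = rn%:Z by exists `|r|%N; move: ddT; lia.
subst K r.
have Em : m = (size lam * Kn + rn)%N by move: nA; rewrite -PoszM -PoszD => -[].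
have rT' : (rn < T)%N by move: rT; lia.
have rL : (size al + size be <= rn)%N by move: rM' ddT Sal Sbe; clear; lia.
have Emk : m = (size al + k * size lam + size be)%N by rewrite -Sp.
(* With [Kn > k] the turns would take more than [k * size lam] steps and the other [rn] steps at
   least as many as [al] and [be]: too many for [m]. *)
have kK : (Kn <= k)%N.
  rewrite leqNgt; apply/negP => ltk.
  have : (k * size lam < size lam * Kn)%N by rewrite mulnC ltn_pmul2l.
  by move: Em Emk rL; clear; lia.
(* The surplus turns join [al], so that [al'] and [be] together take exactly [rn] steps. *)
pose al' := al ++ flatten (nseq (k - Kn) lam).
have Wal' : walk E u al' v by apply: walk_comp Wal _; apply: walk_nseq.
have Sal' : (size al' + size be = rn)%N.
  rewrite size_cat size_nseq_flatten mulnBl.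
  have : (Kn * size lam <= k * size lam)%N by rewrite leq_mul2r kK orbT.
  by move: Em Emk; rewrite mulnC; clear; lia.
have al'T : (size al' < T)%N by apply: leq_ltn_trans rT'; rewrite -Sal' leq_addr.
have := walk_potential (t0 := 0%N) HY Wal'; rewrite add0n mulr1 => /(_ (ltnW al'T)).
have := walk_potential HZ Wbe (t0 := size al'); rewrite Sal' mulr1 => /(_ (ltnW rT')).
have lT : (size lam <= T)%N by case/andP: lM => _ /leq_trans; apply.
have := walk_potential (t0 := 0%N) HU Wl; rewrite add0n => /(_ lT).
have [_ _ _ [_ jump] _] := HB _ _ al'T Eu.
have [_ _ _ _ [[//|fin] _]] := HB _ _ rT' Ez.
rewrite Du in h1; rewrite Dz in fin.
rewrite weight_cat weight_nseq -subzn //.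
move: Hw jump fin h1 U0; rewrite mulrBl [weight lam * _]mulrC.
move: (_ * weight lam) (_ * weight lam) => a b; clear; lia.
Qed.

(** For large [m] the remainder is the representative of [m] modulo [l] in the window of [l]
    integers from [T - M] on; it stays below [T] because [l <= M]. *)
Lemma turns_exist (l : nat) : (0 < l <= M)%N -> exists K r : nat,
  [/\ m = (l * K + r)%N, (r < T)%N & m = r \/ (T <= r + M)%N].
Proof.
move=> /andP[l0 lM]; case: (ltnP m T) => mT.
  by exists 0%N, m; split=> //; [rewrite muln0 | left].
have lt := ltn_pmod (m - (T - M)) l0.
exists ((m - (T - M)) %/ l)%N, (T - M + (m - (T - M)) %% l)%N.
have := divn_eq (m - (T - M)) l; rewrite [X in _ = (X + _)%N]mulnC.
by move: (_ * _)%N (_ %% _)%N lt lM mT M_le_T => a b *; split; [lia|lia|right; lia].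
Qed.

(** The potentials are trajectories: [Y] from [y] at time 0, [U] from 0 at [v] with weights times
    [K], and [Z] from [Y t v + U l v] at [v] at every time [t]. A value of [Z] at time [r] that does
    not stem from a floor comes from a walk to [v], [K] copies of a closed walk of length [l] and a
    walk from [v]; their total length is [m], so the assumption bounds it. *)
Lemma certificate_complete :
  respects_walks E m y y' ->
  forall l v, (0 < l <= M)%N -> exists K r A Y U Z,
     forall t e, (t < T)%N -> e \in E ->
       block_ok m%:Z y y' M T l v K r A Y U Z t e.
Proof.
move=> H l v lM; have [K [r [Em rT rM]]] := turns_exist lM.
have lT : (l <= T)%N by case/andP: lM => _ /leq_trans; apply.
pose D1 := \sum_i `|y i|; pose D2 := \sum_i `|y' i|; pose C := absweight E.
(* Large enough that a value of [Z] stemming from a floor is at most [- D2], whatever else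
   contributes: up to [D1 + T * C] from [Y], [K * T * C] from [U] and [T * C] from the walk in
   [Z]. *)
pose b : int := D1 + D2 + T%:Z * C + T%:Z * C + K%:Z * (T%:Z * C).
pose fY (t : nat) i : int := if t == 0%N then y i else - b.
pose fU (t : nat) i : int := if (t == 0%N) && (i == v) then 0 else - b.
pose Y := traj E fY 1; pose U := traj E fU K%:Z.
pose fZ (t : nat) i : int := if i == v then Y t v + U l v else - b.
pose Z := traj E fZ 1.
have C0 : 0 <= C by apply: absweight_ge0.
have D10 : 0 <= D1 by apply: sumr_ge0.
have D20 : 0 <= D2 by apply: sumr_ge0.
have TC0 : 0 <= T%:Z * C by apply: mulr_ge0.
have KTC0 : 0 <= K%:Z * (T%:Z * C) by apply: mulr_ge0.
have Wb u p z : walk E u p z -> (size p <= T)%N -> `|weight p| <= T%:Z * C.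
  move=> W L; apply: le_trans (weight_bound W) _.
  by apply: ler_wpM2r => //; rewrite lez_nat.
have origY t j : (t <= T)%N -> (exists u p, [/\ walk E u p j, size p = t &
     Y t j = y u - weight p]) \/ Y t j <= T%:Z * C - b.
  move=> tT; rewrite /Y; have [t' [u [p [t't W Sp ->]]]] := traj_origin E fY 1 t j.
  have := Wb _ _ _ W; rewrite /fY mul1r => bw.
  case: eqP => [Et'|_]; last by right; have := bw ltac:(lia); clear; lia.
  by left; exists u, p; split=> //; rewrite Sp Et' subn0.
have origU : (exists2 p, walk E v p v /\ size p = l & U l v = - (K%:Z * weight p))
     \/ U l v <= K%:Z * (T%:Z * C) - b.
  rewrite /U; have [t' [u [p [t't W Sp ->]]]] := traj_origin E fU K%:Z l v.
  have bw : `|K%:Z * weight p| <= K%:Z * (T%:Z * C).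
    by rewrite normrM [`|K%:Z|]ger0_norm // ler_wpM2l // (Wb _ _ _ W) //; lia.
  rewrite /fU; case: ifP => [/andP[/eqP Et' /eqP Eu]|_].
    left; exists p; last by rewrite sub0r.
    by split; [rewrite -{1}Eu | rewrite Sp Et' subn0].
  by right; move: (_ * weight p) bw => w; clear; lia.
have boundY t j : (t <= T)%N -> Y t j <= D1 + T%:Z * C.
  move=> tT; case: (origY t j tT) => [[u [p [W Sp ->]]]|]; last by move: KTC0 D20; rewrite /b; lia.
  have := Wb _ _ _ W; rewrite Sp => /(_ tT); have := state_bound y u.
  by rewrite -/D1; clear; lia.
have boundU : U l v <= K%:Z * (T%:Z * C).
  case: origU => [[p [W Sp] ->]|]; last by move: TC0 D10 D20 KTC0; rewrite /b; lia.
  rewrite -mulrN ler_wpM2l //; have := Wb _ _ _ W; rewrite Sp => /(_ lT).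
  by clear; lia.
exists K%:Z, r%:Z, (fun t => t%:Z * K%:Z), Y, U, Z => t e tT He.
split.
- by split=> //; [rewrite -[1]/(1%:Z) -PoszD lez_nat addn1 |
   case: rM => [->|]; [left|right; rewrite -PoszD lez_nat]].
- by split; [rewrite mul0r | rewrite intS mulrDl mul1r addrC | rewrite -PoszM -PoszD Em].
- split.
  + exact: (traj_ge_source E fY 1 0 (src e)).
  + by have := traj_step fY 1 t He; rewrite mul1r.
  + by have := traj_step fU K%:Z t He; rewrite [wt e * _]mulrC.
  + by have := traj_step fZ 1 t He; rewrite mul1r.
- split; first by have := traj_ge_source E fU K%:Z 0 v; rewrite {1}/fU !eqxx.
  by have := traj_ge_source E fZ 1 t v; rewrite {1}/fZ eqxx.
split.
  have [rt|/eqP rt] := eqVneq r t; last by left => -[].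
  right; have y'b : - D2 <= y' (dst e).
    by have := state_bound y' (dst e); rewrite -/D2; clear; lia.
  rewrite {1}/Z; have [t' [u [p [t't W Sp ->]]]] := traj_origin E fZ 1 t (dst e).
  have sp : (size p <= T)%N by rewrite Sp (leq_trans (leq_subr _ _)) // ltnW.
  have wp := Wb _ _ _ W sp; rewrite mul1r /fZ; case: eqP => [Eu|_]; last first.
    by move: wp y'b D10 D20 TC0 KTC0; rewrite /b; clear; lia.
  rewrite Eu in W; have t'T : (t' <= T)%N by apply: leq_trans t't (ltnW tT).
  case: (origY t' v t'T) => [[u0 [p0 [W0 S0 EY]]]|hY]; last first.
    by move: wp y'b hY boundU; rewrite /b; move: (K%:Z * _) D10 D20 => X; clear; lia.
  case: origU => [[p1 [W1 S1] EU]|hU]; last first.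
    by move: wp y'b hU (boundY t' v t'T); rewrite /b; move: (K%:Z * _) => X; clear; lia.
  have W2 := walk_comp W0 (walk_comp (walk_nseq K W1) W).
  have := H _ _ _ W2; rewrite !size_cat size_nseq_flatten S0 S1 Sp => /(_ _).
  rewrite !weight_cat weight_nseq EY EU.
  have -> : (t' + (K * l + (t - t')))%N = m.
    by rewrite Em rt mulnC; move: (K * l)%N t't => X; clear; lia.
  by move=> /(_ erefl); move: (K%:Z * _) => X; clear; lia.
have [mt|/eqP mt] := eqVneq m t; last by left => -[].
right; have [[u [p [W Sp ->]]]|] := origY t (dst e) (ltnW tT).
  by have := H _ _ _ W; rewrite Sp mt => /(_ erefl); lia.
have := state_bound y' (dst e); rewrite -/D2 /b.
by lia.
Qed.

End Certificate.

(** * The formula *)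

Definition dvar_code (N : nat) (u : dvar N) : 'I_N + 'I_N :=
  match u with Cur i => inl i | Nxt i => inr i end.
Definition dvar_decode (N : nat) (u : 'I_N + 'I_N) : dvar N :=
  match u with inl i => Cur i | inr i => Nxt i end.
Lemma dvar_codeK (N : nat) : cancel (@dvar_code N) (@dvar_decode N).
Proof. by case. Qed.
HB.instance Definition _ (N : nat) :=
  Equality.copy (dvar N) (can_type (@dvar_codeK N)).

Definition datom_code (N : nat) (a : datom N) : dvar N * dvar N * int :=
  (d_pos a, d_neg a, d_bound a).
Definition datom_decode (N : nat) (p : dvar N * dvar N * int) : datom N :=
  DAtom p.1.1 p.1.2 p.2.
Lemma datom_codeK (N : nat) : cancel (@datom_code N) (@datom_decode N).
Proof. by case. Qed.
HB.instance Definition _ (N : nat) :=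
  Equality.copy (datom N) (can_type (@datom_codeK N)).

Definition dvar_index (N : nat) (u : dvar N) : 'I_N :=
  match u with Cur i => i | Nxt i => i end.

Definition dvar_tag (N : nat) (u : dvar N) : bool :=
  match u with Cur _ => false | Nxt _ => true end.

Lemma enc_dvarE (N : nat) (u : dvar N) :
  enc_dvar u = dvar_tag u :: enc_nat (dvar_index u).
Proof. by case: u. Qed.

Definition edge (N : nat) (a : datom N) : 'I_N * 'I_N * int :=
  (dvar_index (d_pos a), dvar_index (d_neg a), d_bound a).

Definition announce (u : seq bool) : seq bool :=
  flatten [seq [:: true; b] | b <- u].

Lemma announce_cat u v : announce (u ++ v) = announce u ++ announce v.
Proof. by rewrite /announce map_cat flatten_cat. Qed.

Fixpoint bits_pos (u : seq bool) : positive :=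
  match u with
  | [::] => xH
  | b :: u' => if b then xI (bits_pos u') else xO (bits_pos u')
  end.

Lemma bits_posK u : pos_bits (bits_pos u) = rcons u true.
Proof. by elim: u => [|[] u IH] //=; rewrite IH. Qed.

(* Binary numbers have no leading zero, so the name gets a final 1. *)
Definition bits_nat (u : seq bool) : nat := nat_of_bin (Npos (bits_pos u)).

(** An encoded name consists of its own bits, each announced by a 1, and a fixed ending, so that it
    can be written bit by bit without arithmetic. *)
Lemma enc_bits_nat u : enc_nat (bits_nat u) = announce u ++ [:: true; true; false].
Proof.
rewrite /enc_nat /nat_bits /bits_nat nat_of_binK bits_posK -cats1 -/(announce _).
by rewrite announce_cat -catA.
Qed.

Lemma bits_nat_inj : injective bits_nat.
Proof.
move=> u v /(congr1 nat_bits); rewrite /nat_bits /bits_nat !nat_of_binK !bits_posK.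
by move/rcons_inj => [].
Qed.

(* K turns of a cycle, then r more steps; A t stands for t * K, which expresses
   l * K by repeated addition; Y, U and Z are the potentials. *)
Inductive auxkind : Type := FamK | FamR | FamA | FamY | FamU | FamZ.

Definition auxkind_bits (f : auxkind) : seq bool :=
  match f with
  | FamK => [:: false; false; false] | FamR => [:: false; false; true]
  | FamA => [:: false; true; false] | FamY => [:: false; true; true]
  | FamU => [:: true; false; false] | FamZ => [:: true; false; true]
  end.

Lemma auxkind_bits_inj : injective auxkind_bits.
Proof. by do 2!case. Qed.
HB.instance Definition _ := Equality.copy auxkind (inj_type auxkind_bits_inj).

Section Names.
Variable N : nat.

Definition name_key : Type := auxkind * nat * 'I_N * nat * 'I_N.

(** [l] and [t] are unary, like the loop counters of the program; [v] and [i] have the encoding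
    under which they occur in the input. Each part is self-delimiting, whence injectivity. *)
Definition name_bits (k : name_key) : seq bool :=
  let: (f, l, v, t, i) := k in
  auxkind_bits f ++ nseq l true ++ false :: enc_nat v ++
    nseq t true ++ false :: enc_nat i.

Definition name (k : name_key) : nat := bits_nat (name_bits k).

Lemma unary_inj l l' (u u' : seq bool) :
  nseq l true ++ false :: u = nseq l' true ++ false :: u' -> l = l' /\ u = u'.
Proof.
elim: l l' => [|l IH] [|l'] //= []; first by move=> ->.
by move=> /IH[-> ->].
Qed.

Lemma name_inj : injective name.
Proof.
move=> [[[[f l] v] t] i] [[[[f' l'] v'] t'] i'] /bits_nat_inj.
rewrite /name_bits => E; have [-> {}E] : f = f' /\
    nseq l true ++ false :: enc_nat v ++ nseq t true ++ false :: enc_nat i =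
    nseq l' true ++ false :: enc_nat v' ++ nseq t' true ++ false :: enc_nat i'.
  by case: f f' E => [] [] //= [].
have [-> /enc_nat_inj [/val_inj -> /unary_inj [->]]] := unary_inj E.
rewrite -[enc_nat i]cats0 -[enc_nat i']cats0 => /enc_nat_inj [/val_inj -> _].
by [].
Qed.

End Names.

(** Selectors denote a time, a vertex or a number relative to the current point. They let one
    template serve both as a formula at each point and as instructions for writing that formula. *)
Inductive tsel : Type := AtZero | AtL | AtT | AtTS.
Inductive vsel : Type := SrcV | DstV | PivotV.
Inductive numsel : Type := NumBound | NumSize | NumT.

Definition tsel_code (s : tsel) : nat :=
  match s with AtZero => 0 | AtL => 1 | AtT => 2 | AtTS => 3 end.
Lemma tsel_code_inj : injective tsel_code.
Proof. by do 2!case. Qed.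
HB.instance Definition _ := Equality.copy tsel (inj_type tsel_code_inj).

Definition vsel_code (s : vsel) : nat :=
  match s with SrcV => 0 | DstV => 1 | PivotV => 2 end.
Lemma vsel_code_inj : injective vsel_code.
Proof. by do 2!case. Qed.
HB.instance Definition _ := Equality.copy vsel (inj_type vsel_code_inj).

Inductive sterm : Type :=
| SAux of auxkind & tsel & vsel
| SIter | SPos | SNeg
| SNum of numsel
| SConst of int
| SAdd of sterm & sterm
| SBound
| SScale of sterm.

Inductive sform : Type :=
| SLe of sterm & sterm
| SEq of sterm & sterm
| SNot of sform
| SAnd of sform & sform
| SOr of sform & sform.

Record point (N : nat) : Type := Point {
  pt_len : nat;
  pt_pivot : 'I_N;
  pt_time : nat;
  pt_atom : datom N
}.

Definition point_code (N : nat) (x : point N) : nat * 'I_N * nat * datom N :=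
  (pt_len x, pt_pivot x, pt_time x, pt_atom x).
Definition point_decode (N : nat) (p : nat * 'I_N * nat * datom N) : point N :=
  let: (l, v, t, a) := p in Point l v t a.
Lemma point_codeK (N : nat) : cancel (@point_code N) (@point_decode N).
Proof. by case. Qed.
HB.instance Definition _ (N : nat) :=
  Equality.copy (point N) (can_type (@point_codeK N)).

Section Templates.
Variables (N M T : nat).

Notation point := (point N).

Definition tsel_val (x : point) (s : tsel) : nat :=
  match s with
  | AtZero => 0%N | AtL => pt_len x | AtT => pt_time x | AtTS => (pt_time x).+1
  end.

Definition vsel_val (x : point) (s : vsel) : 'I_N :=
  match s with
  | SrcV => dvar_index (d_pos (pt_atom x))
  | DstV => dvar_index (d_neg (pt_atom x))
  | PivotV => pt_pivot x
  end.

Definition numsel_val (x : point) (s : numsel) : nat :=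
  match s with NumBound => T | NumSize => M | NumT => pt_time x end.

(** Unary on purpose: a stack of [n] symbols becomes this term when each symbol is replaced by a
    fixed word, and the numbers involved are polynomial in the input. *)
Definition numeral (n : nat) : pterm N := iter n (PAdd (PConst 1)) (PConst 0).

Definition key (x : point) (f : auxkind) (s : tsel) (w : vsel) : name_key N :=
  (f, pt_len x, pt_pivot x, tsel_val x s, vsel_val x w).

Fixpoint term_of (x : point) (s : sterm) : pterm N :=
  match s with
  | SAux f t v => PVar (Aux (name (key x f t v)))
  | SIter => PVar Iter
  | SPos => PVar (Sys (d_pos (pt_atom x)))
  | SNeg => PVar (Sys (d_neg (pt_atom x)))
  | SNum n => numeral (numsel_val x n)
  | SConst c => PConst c
  | SAdd s1 s2 => PAdd (term_of x s1) (term_of x s2)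
  | SBound => PConst (d_bound (pt_atom x))
  | SScale s1 => PScale (d_bound (pt_atom x)) (term_of x s1)
  end.

Fixpoint form_of (x : point) (s : sform) : pform N :=
  match s with
  | SLe s1 s2 => PLe (term_of x s1) (term_of x s2)
  | SEq s1 s2 => PEq (term_of x s1) (term_of x s2)
  | SNot s1 => PNot (form_of x s1)
  | SAnd s1 s2 => PAnd (form_of x s1) (form_of x s2)
  | SOr s1 s2 => POr (form_of x s1) (form_of x s2)
  end.

End Templates.

Fixpoint term_auxs (s : sterm) : seq (auxkind * tsel * vsel) :=
  match s with
  | SAux f t v => [:: (f, t, v)]
  | SAdd s1 s2 => term_auxs s1 ++ term_auxs s2
  | SScale s1 => term_auxs s1
  | _ => [::]
  end.

Fixpoint form_auxs (s : sform) : seq (auxkind * tsel * vsel) :=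
  match s with
  | SLe s1 s2 | SEq s1 s2 => term_auxs s1 ++ term_auxs s2
  | SNot s1 => form_auxs s1
  | SAnd s1 s2 | SOr s1 s2 => form_auxs s1 ++ form_auxs s2
  end.

Definition kS := SAux FamK AtZero PivotV.
Definition rS := SAux FamR AtZero PivotV.

(** The conjuncts of [block_ok] as a template. Those independent of the time or the atom recur at
    every point, so that the loop body is always the same. *)
Definition block : sform :=
  foldr SAnd (SLe (SConst 0) kS) [::
    SLe (SAdd rS (SConst 1)) (SNum NumBound);
    SOr (SEq SIter rS) (SLe (SNum NumBound) (SAdd rS (SNum NumSize)));
    SEq (SAux FamA AtZero PivotV) (SConst 0);
    SEq (SAux FamA AtTS PivotV) (SAdd (SAux FamA AtT PivotV) kS);
    SEq SIter (SAdd (SAux FamA AtL PivotV) rS);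
    SLe SPos (SAux FamY AtZero SrcV);
    SLe (SAux FamY AtT SrcV) (SAdd (SAux FamY AtTS DstV) SBound);
    SLe (SAux FamU AtT SrcV) (SAdd (SAux FamU AtTS DstV) (SScale kS));
    SLe (SAux FamZ AtT SrcV) (SAdd (SAux FamZ AtTS DstV) SBound);
    SLe (SConst 0) (SAux FamU AtZero PivotV);
    SLe (SAdd (SAux FamY AtT PivotV) (SAux FamU AtL PivotV)) (SAux FamZ AtT PivotV);
    SOr (SNot (SEq rS (SNum NumT))) (SLe (SAux FamZ AtT DstV) SNeg);
    SOr (SNot (SEq SIter (SNum NumT))) (SLe (SAux FamY AtT DstV) SNeg)].

Arguments block : simpl never.

Section Semantics.
Variables (N M T : nat).

Notation term_of := (@term_of N M T).
Notation form_of := (@form_of N M T).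

Lemma numeral_val (nu : pvar N -> int) n : pterm_val nu (numeral N n) = n%:Z.
Proof. by elim: n => //= n ->; rewrite intS. Qed.

Lemma sat_block (nu : pvar N -> int) (y y' : state N) (x : point N) :
  let val f t i := nu (Aux (name (f, pt_len x, pt_pivot x, t, i))) in
  let v := pt_pivot x in
  nu (Sys (d_pos (pt_atom x))) = y (dvar_index (d_pos (pt_atom x))) ->
  nu (Sys (d_neg (pt_atom x))) = y' (dvar_index (d_neg (pt_atom x))) ->
  sat nu (form_of x block) <->
  block_ok (nu Iter) y y' M T (pt_len x) v (val FamK 0%N v) (val FamR 0%N v)
    (fun t => val FamA t v) (val FamY) (val FamU) (val FamZ)
    (pt_time x) (edge (pt_atom x)).
Proof.
move=> val v; rewrite /block_ok /block /= !numeral_val => -> ->.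
rewrite /src /dst /wt /= -/v.
split.
  by move=> H; decompose [and] H; do !split.
by move=> [[? ? ?] [? ? ?] [? ? ? ?] [? ?] [? ?]]; do !split.
Qed.

Definition names (x : point N) : seq nat :=
  [seq name (key x p.1.1 p.1.2 p.2) | p <- form_auxs block].

Definition ptrue : pform N := PLe (PConst 0) (PConst 0).

Definition conj_blocks (xs : seq (point N)) : pform N :=
  foldr (fun x => PAnd (form_of x block)) ptrue xs.

(** A variable is quantified once for each of its occurrences, which spares the program from
    detecting repetitions; the innermost binder counts. *)
Definition formula (xs : seq (point N)) : pform N :=
  foldr (@PEx N) (conj_blocks xs) (flatten [seq names x | x <- xs]).

Lemma quantifier_free_form x s : quantifier_free (form_of x s).
Proof. by elim: s => //= s1 -> s2 ->. Qed.

Lemma existential_formula xs : existential (formula xs).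
Proof.
rewrite /formula; elim: (flatten _) => //=.
have H : quantifier_free (conj_blocks xs).
  by elim: xs => //= x xs ->; rewrite quantifier_free_form.
by case: (conj_blocks xs) H.
Qed.

Lemma scoped_term bound x s :
  {subset [seq name (key x p.1.1 p.1.2 p.2) | p <- term_auxs s] <= bound} ->
  pterm_scoped bound (term_of x s).
Proof.
elim: s => //= [f t v|n|s1 IH1 s2 IH2] H.
- by apply: H; rewrite mem_head.
- by elim: (numsel_val _ _ _ _).
- by rewrite IH1 ?IH2 // => y Hy; apply: H; rewrite map_cat mem_cat Hy ?orbT.
Qed.

Lemma scoped_form bound x s :
  {subset [seq name (key x p.1.1 p.1.2 p.2) | p <- form_auxs s] <= bound} ->
  scoped bound (form_of x s).
Proof.
elim: s => //= [s1 s2|s1 s2|s1 IH1 s2 IH2|s1 IH1 s2 IH2] H.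
- by rewrite !scoped_term // => y Hy; apply: H; rewrite map_cat mem_cat Hy ?orbT.
- by rewrite !scoped_term // => y Hy; apply: H; rewrite map_cat mem_cat Hy ?orbT.
- by rewrite IH1 ?IH2 // => y Hy; apply: H; rewrite map_cat mem_cat Hy ?orbT.
- by rewrite IH1 ?IH2 // => y Hy; apply: H; rewrite map_cat mem_cat Hy ?orbT.
Qed.

Lemma scoped_prefix bound ks (g : pform N) :
  scoped bound (foldr (@PEx N) g ks) = scoped (rev ks ++ bound) g.
Proof. by elim: ks bound => //= k ks IH bound; rewrite IH rev_cons cat_rcons. Qed.

Lemma scoped_formula xs : scoped [::] (formula xs).
Proof.
rewrite /formula scoped_prefix cats0.
have : {subset flatten [seq names x | x <- xs] <= rev (flatten [seq names x | x <- xs])}.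
  by move=> k; rewrite mem_rev.
move: (rev _) => ks; elim: xs => [//|x ys IH] H.
rewrite -[scoped _ _]/(scoped ks (form_of x block) && scoped ks (conj_blocks ys)).
apply/andP; split.
  by apply: scoped_form => k Hk; apply: H; rewrite mem_cat Hk.
by apply: IH => k Hk; apply: H; rewrite mem_cat Hk orbT.
Qed.

(** Even with repetitions in [ks], the prefix amounts to a free choice of values for the names it
    contains. *)
Lemma sat_prefix nu ks (g : pform N) :
  sat nu (foldr (@PEx N) g ks) <->
  exists2 nu', (forall u, (forall k, u = Aux k -> k \notin ks) -> nu' u = nu u) &
    sat nu' g.
Proof.
elim: ks nu => [|k ks IH] nu /=; split.
- by exists nu.
- move=> [nu' H]; suff -> : nu' = nu by [].
  by apply: functional_extensionality => u; apply: H.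
- move=> [z /IH[nu' H S]]; exists nu' => // u Hu; rewrite H.
    case: u Hu => //= j /(_ j erefl); rewrite inE negb_or => /andP[/negbTE -> _] //.
  by move=> j /Hu; rewrite inE negb_or => /andP[].
- move=> [nu' H S]; exists (nu' (Aux k)); apply/IH; exists nu' => // u Hu.
  case: u Hu => [|w|j] Hu; try by rewrite H.
  rewrite /=; case: eqP => [->//|/eqP jk]; apply: H => _ [<-].
  by rewrite inE negb_or jk Hu.
Qed.

Lemma sat_conj_blocks nu xs :
  sat nu (conj_blocks xs) <-> forall x, x \in xs -> sat nu (form_of x block).
Proof.
elim: xs => [|x xs IH] /=; split=> //.
- by move=> [Sx /IH S] z; rewrite inE => /predU1P[->|/S].
- move=> S; split; first by apply: S; rewrite mem_head.
  by apply/IH => z Hz; apply: S; rewrite inE Hz orbT.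
Qed.

End Semantics.

(** * The formula is a closed form *)

Lemma rel_pow_iff (A : Type) (R S : A -> A -> Prop) m x y :
  (forall x y, R x y <-> S x y) -> rel_pow R m x y <-> rel_pow S m x y.
Proof.
move=> RS; elim: m x => //= m IH x.
by split=> -[z Hz /IH P]; exists z => //; apply/RS.
Qed.

Lemma rel_pow_snoc (A : Type) (R : A -> A -> Prop) m x y z :
  rel_pow R m x y -> R y z -> rel_pow R m.+1 x z.
Proof.
elim: m x => [|m IH] x /=; first by move=> -> H; exists z.
by move=> [w Rxw /IH H] /H Hz; exists w.
Qed.

Lemma rel_pow_converse (A : Type) (R : A -> A -> Prop) m x y :
  rel_pow (fun a b => R b a) m x y <-> rel_pow R m y x.
Proof.
suff H (S : A -> A -> Prop) a b : rel_pow (fun a b => S b a) m a b -> rel_pow S m b a.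
  by split; [apply: H | apply: (H (fun a b => R b a))].
elim: m a => [|m IH] a /=; first by move->.
by move=> [z Sza /IH P]; apply: rel_pow_snoc P Sza.
Qed.

Section ClosedForm.
Variables (N : nat) (R : dbc N).

(** Pivots are the negative ends of atoms, since each vertex of a cycle is the target of an edge.
    The nesting is that of the loops of the program. *)
Definition points (M T : nat) : seq (point N) :=
  flatten [seq flatten [seq flatten [seq
    [seq Point l (dvar_index (d_neg c)) t a | a <- R]
    | t <- iota 0 T] | c <- R] | l <- iota 1 M].

Lemma mem_points M T x : x \in points M T <->
  [/\ (0 < pt_len x <= M)%N, pt_pivot x \in map dst (map (@edge N) R),
      (pt_time x < T)%N & pt_atom x \in R].
Proof.
split.
  move=> /flatten_mapP[l Hl /flatten_mapP[c Hc /flatten_mapP[t Ht /mapP[a Ha ->]]]] /=.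
  split=> //; last by move: Ht; rewrite mem_iota.
    by move: Hl; rewrite mem_iota add1n ltnS.
  by rewrite -map_comp; apply/mapP; exists c.
case: x => l v t a [/= Hl]; rewrite -map_comp => /mapP[c Hc ->] Ht Ha.
apply/flatten_mapP; exists l; first by rewrite mem_iota add1n ltnS.
apply/flatten_mapP; exists c => //.
apply/flatten_mapP; exists t; first by rewrite mem_iota.
exact: map_f.
Qed.

(** For a backward constraint the two states are exchanged: the powers of a converse are the
    converses of the powers. *)
Lemma dbc_rel_directed (x x' : state N) : one_directional R ->
  exists y y' : state N,
  [/\ forall a, a \in R -> dvar_val x x' (d_pos a) = y (dvar_index (d_pos a)),
      forall a, a \in R -> dvar_val x x' (d_neg a) = y' (dvar_index (d_neg a)) &
      forall m, rel_pow (dbc_rel R) m x x' <->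
        rel_pow (edge_rel (map (@edge N) R)) m y y'].
Proof.
case/orP => dirR; [exists x, x' | exists x', x]; split.
- by move=> a /(allP dirR); rewrite /forward_atom; case: (d_pos a).
- by move=> a /(allP dirR); rewrite /forward_atom; case: (d_pos a); case: (d_neg a).
- move=> m; apply: rel_pow_iff => z z'; split.
    move=> /allP H e /mapP[a Ha ->]; have := H _ Ha; have := allP dirR _ Ha.
    rewrite /forward_atom /edge /src /dst /wt /=.
    by case: (d_pos a) => //= i; case: (d_neg a) => //= j _; lia.
  move=> H; apply/allP => a Ha; have := H _ (map_f _ Ha); have := allP dirR _ Ha.
  rewrite /forward_atom /edge /src /dst /wt /=.
  by case: (d_pos a) => //= i; case: (d_neg a) => //= j _; lia.
- by move=> a /(allP dirR); rewrite /backward_atom; case: (d_pos a).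
- by move=> a /(allP dirR); rewrite /backward_atom; case: (d_pos a); case: (d_neg a).
move=> m; apply: iff_trans (rel_pow_converse _ _ _ _).
apply: rel_pow_iff => z z'; split.
  move=> /allP H e /mapP[a Ha ->]; have := H _ Ha; have := allP dirR _ Ha.
  rewrite /backward_atom /edge /src /dst /wt /=.
  by case: (d_pos a) => //= i; case: (d_neg a) => //= j _; lia.
move=> H; apply/allP => a Ha; have := H _ (map_f _ Ha); have := allP dirR _ Ha.
rewrite /backward_atom /edge /src /dst /wt /=.
by case: (d_pos a) => //= i; case: (d_neg a) => //= j _; lia.
Qed.

(** The points are reversed because the program puts each new word in front of those already
    written. *)
Lemma closed_form_formula (M T : nat) :
  one_directional R -> (7 * size R < M)%N -> T = (M * M)%N ->
  closed_form R (formula M T (rev (points M T))).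
Proof.
move=> dirR LM ET; split; first exact: scoped_formula.
move=> m x x' m0; have [y [y' [Hy Hy' ->]]] := dbc_rel_directed x x' dirR.
set E := map _ _; have LE : (7 * size E < M)%N by rewrite size_map.
rewrite rel_pow_walks //.
have names_used z f s w : z \in points M T -> (f, s, w) \in form_auxs block ->
    name (key z f s w) \in flatten [seq names u | u <- rev (points M T)].
  move=> Hz Hf; apply/flatten_mapP; exists z; first by rewrite mem_rev.
  exact: (map_f (fun p => name (key z p.1.1 p.1.2 p.2)) Hf).
split.
  move=> /sat_prefix[nu Hnu /sat_conj_blocks S].
  have nuS u : nu (Sys u) = dvar_val x x' u by apply: Hnu.
  have nuI : nu Iter = m%:Z by apply: Hnu.
  apply: (certificate_sound m0 LE ET) => l v Ll Hv.
  pose val f t i := nu (Aux (name (f, l, v, t, i))).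
  exists (val FamK 0%N v), (val FamR 0%N v), (fun t => val FamA t v), (val FamY),
    (val FamU), (val FamZ) => t e tT /mapP[a Ha ->].
  have Hp : Point l v t a \in points M T by apply/mem_points.
  have := S (Point l v t a); rewrite mem_rev => /(_ Hp) Sa.
  have := @sat_block N M T nu y y' (Point l v t a).
  by rewrite !nuS nuI => /(_ (Hy _ Ha) (Hy' _ Ha)) [/(_ Sa)].
move=> H.
(* One certificate is chosen per length and pivot, because all blocks with the same [l] and [v]
   share their variables; for lengths out of range the constant 0 stands in. *)
have cert : forall lv : nat * 'I_N, exists F : auxkind -> nat -> 'I_N -> int,
    (0 < lv.1 <= M)%N -> forall t e, (t < T)%N -> e \in E ->
      block_ok m%:Z y y' M T lv.1 lv.2 (F FamK 0%N lv.2) (F FamR 0%N lv.2)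
        (fun t => F FamA t lv.2) (F FamY) (F FamU) (F FamZ) t e.
  move=> [l v] /=; case: (boolP (0 < l <= M)%N) => Ll; last by exists (fun _ _ _ => 0).
  have [K [r [A [Y [U [Z HB]]]]]] := certificate_complete m0 LE ET H v Ll.
  by exists (fun f t i => match f with
    | FamK => K | FamR => r | FamA => A t | FamY => Y t i | FamU => U t i
    | FamZ => Z t i end).
have [F HF] := ClassicalChoice.choice _ cert.
pose value (k : name_key N) := let: (f, l, v, t, i) := k in F (l, v) f t i.
pose used k := k \in flatten [seq names u | u <- rev (points M T)].
(* A quantified name is decoded to its tuple, which is unique by injectivity; every other auxiliary
   variable keeps the value 0 it has in [valuation]. *)
pose nu (u : pvar N) : int := match u with
  | Aux k => if used k then
      if excluded_middle_informative (exists q, name q = k) is left ex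
      then value (proj1_sig (constructive_indefinite_description _ ex)) else 0
    else 0
  | _ => valuation m%:Z x x' u end.
have nuE q : used (name q) -> nu (Aux (name q)) = value q.
  rewrite /nu => ->; case: excluded_middle_informative => [ex|[]]; last by exists q.
  by case: constructive_indefinite_description => q' /= /name_inj ->.
apply/sat_prefix; exists nu.
  by case=> // k /(_ _ erefl) /negbTE; rewrite /nu /used => ->.
apply/sat_conj_blocks => z; rewrite mem_rev => Hz.
have /mem_points [Lz Hv Ht Ha] := Hz.
have nuI : nu Iter = m%:Z by [].
have nuS u : nu (Sys u) = dvar_val x x' u by [].
have use f s w : (f, s, w) \in form_auxs block -> nu (Aux (name (key z f s w))) =
   F (pt_len z, pt_pivot z) f (tsel_val z s) (vsel_val z w).
  by move=> Hf; rewrite nuE //; apply: names_used.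
move: nu nuI nuS use {nuE} => nu nuI nuS use.
apply/(@sat_block N M T nu y y' z); rewrite ?nuS ?nuI; [exact: Hy|exact: Hy'|].
have := HF (pt_len z, pt_pivot z) Lz _ _ Ht (map_f _ Ha).
rewrite /block_ok -(use FamK AtZero PivotV isT) -(use FamR AtZero PivotV isT) -(use FamA
  AtZero PivotV isT) -(use FamA AtTS PivotV isT) -(use FamA AtT PivotV isT)
  -(use FamA AtL PivotV isT) -(use FamY AtZero SrcV isT) -(use FamY AtT SrcV
  isT) -(use FamY AtTS DstV isT) -(use FamU AtT SrcV isT) -(use FamU AtTS DstV
  isT) -(use FamZ AtT SrcV isT) -(use FamZ AtTS DstV isT) -(use FamU AtZero
  PivotV isT) -(use FamY AtT PivotV isT) -(use FamU AtL PivotV isT) -(use FamZ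
  AtT PivotV isT) -(use FamZ AtT DstV isT) -(use FamY AtT DstV isT).
exact.
Qed.

End ClosedForm.

(** * Stack programs and their compilation to Turing machines *)

Local Open Scope nat_scope.

Definition store := nat -> seq bool.

Definition upd (s : store) (r : nat) (w : seq bool) : store :=
  fun x => if x == r then w else s x.

(* Stack programs: [Case] and [Loop] pop the stack they test, and [Loop] runs
   until that stack is empty. *)
Inductive cmd : Type :=
| Skip
| Push of nat & bool
| Then of cmd & cmd
| Case of nat & cmd & cmd & cmd
| Loop of nat & cmd & cmd.

(** The last argument is the exact number of steps of the compiled code: a push takes two, each test
    one, and [Skip] one for its jump. *)
Inductive run : cmd -> store -> store -> nat -> Prop :=
| RunSkip s : run Skip s s 1
| RunPush r b s : run (Push r b) s (upd s r (b :: s r)) 2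
| RunThen c d s1 s2 s3 m n :
    run c s1 s2 m -> run d s2 s3 n -> run (Then c d) s1 s3 (m + n)
| RunCaseNil r c1 c0 ce s s' n :
    s r = [::] -> run ce s s' n -> run (Case r c1 c0 ce) s s' n.+1
| RunCase r c1 c0 ce s s' b w n :
    s r = b :: w -> run (if b then c1 else c0) (upd s r w) s' n ->
    run (Case r c1 c0 ce) s s' n.+1
| RunLoopNil r c1 c0 s : s r = [::] -> run (Loop r c1 c0) s s 1
| RunLoop r c1 c0 s1 s2 s3 b w m n :
    s1 r = b :: w -> run (if b then c1 else c0) (upd s1 r w) s2 m ->
    run (Loop r c1 c0) s2 s3 n -> run (Loop r c1 c0) s1 s3 (m + n).+1.

Fixpoint uses_below (k : nat) (c : cmd) : bool :=
  match c with
  | Skip => true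
  | Push r _ => r < k
  | Then c d => uses_below k c && uses_below k d
  | Case r c1 c0 ce =>
      [&& r < k, uses_below k c1, uses_below k c0 & uses_below k ce]
  | Loop r c1 c0 => [&& r < k, uses_below k c1 & uses_below k c0]
  end.

Inductive instr : Type :=
| IJump of nat
| IMoveLeft of nat & nat
| IWrite of nat & bool & nat
| IPop of nat & nat & nat & nat.

Fixpoint clen (c : cmd) : nat :=
  match c with
  | Skip => 1
  | Push _ _ => 2
  | Then c d => clen c + clen d
  | Case _ c1 c0 ce => (clen c1 + (clen c0 + clen ce)).+1
  | Loop _ c1 c0 => (clen c1 + clen c0).+1
  end.

(* The code of [c] when placed at address [a], leaving to address [e]. *)
Fixpoint compile (c : cmd) (a e : nat) : seq instr :=
  match c with
  | Skip => [:: IJump e]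
  | Push r b => [:: IMoveLeft r a.+1; IWrite r b e]
  | Then c d => compile c a (a + clen c) ++ compile d (a + clen c) e
  | Case r c1 c0 ce =>
      let a0 := a.+1 + clen c1 in let ae := a0 + clen c0 in
      IPop r a.+1 a0 ae ::
        compile c1 a.+1 e ++ compile c0 a0 e ++ compile ce ae e
  | Loop r c1 c0 =>
      let a0 := a.+1 + clen c1 in
      IPop r a.+1 a0 e :: compile c1 a.+1 a ++ compile c0 a0 a
  end.

Lemma size_compile c a e : size (compile c a e) = clen c.
Proof.
elim: c a e => //= [c IHc d IHd|r c1 IH1 c0 IH0 ce IHe|r c1 IH1 c0 IH0] a e.
- by rewrite size_cat IHc IHd.
- by rewrite !size_cat IH1 IH0 IHe.
- by rewrite !size_cat IH1 IH0.
Qed.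

Section Machine.
Variables (K : nat) (code : seq instr).

(** The state is the address of the next instruction, and the address just past the code halts. A
    machine step writes before it moves, so a push needs two instructions: move left, then write. *)
Definition instr_trans (q : 'I_(size code).+1)
    (h : {ffun 'I_K.+1 -> symbol}) :
    'I_(size code).+1 * ('I_K.+1 -> symbol * move) :=
  let keep (i : 'I_K.+1) : symbol * move := (h i, Stay) in
  let act (r : nat) (a : symbol * move) (i : 'I_K.+1) :=
    if i == r :> nat then a else keep i in
  match nth (IJump 0) code q with
  | IJump e => (inord e, keep)
  | IMoveLeft r e => (inord e, act r (h (inord r), MoveLeft))
  | IWrite r b e => (inord e, act r (Some b, Stay))
  | IPop r l1 l0 le =>
      match h (inord r) with
      | Some b => (inord (if b then l1 else l0), act r (None, MoveRight))
      | None => (inord le, keep)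
      end
  end.

Definition machine : turing_machine :=
  @TuringMachine K 'I_(size code).+1 (inord 0)
    (fun q => q == size code :> nat) instr_trans.

(** The head scans the top of the stack. The cells to its left are arbitrary, since a push
    overwrites the one it enters; to the right of the word only blanks may follow. *)
Definition holds (t : tape) (w : seq bool) : Prop :=
  exists m, tape_head t :: tape_right t = map Some w ++ nseq m None.

Definition at_pc (a : nat) (s : store) (c : config machine) : Prop :=
  cf_state c = a :> nat /\ forall i : 'I_K.+1, holds (cf_tapes c i) (s i).

Definition subcode (a : nat) (cs : seq instr) : Prop :=
  exists pre post, code = pre ++ cs ++ post /\ size pre = a.

Lemma subcode_catl a c d : subcode a (c ++ d) -> subcode a c.
Proof. by case=> pre [post [E Sp]]; exists pre, (d ++ post); rewrite E -catA. Qed.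

Lemma subcode_catr a c d : subcode a (c ++ d) -> subcode (a + size c) d.
Proof.
case=> pre [post [E <-]]; exists (pre ++ c), post.
by rewrite E size_cat !catA.
Qed.

Lemma subcode_cons a i c : subcode a (i :: c) -> subcode a.+1 c.
Proof. by move=> /(@subcode_catr a [:: i] c); rewrite addn1. Qed.

Lemma subcode_nth a i c : subcode a (i :: c) ->
  nth (IJump 0) code a = i /\ a < size code.
Proof.
case=> pre [post [-> <-]]; rewrite nth_cat ltnn subnn; split=> //.
by rewrite size_cat /= addnS ltnS leq_addr.
Qed.

Lemma holds_head t w : holds t w -> tape_head t = head None (map Some w).
Proof. by case: t => l h r [[|m]]; case: w => [|b w] //= []. Qed.

Lemma holds_stay t w : holds t w -> holds (write_move t (tape_head t, Stay)) w.
Proof. by case: t. Qed.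

Lemma holds_pop t b w : holds t (b :: w) ->
  holds (write_move t (None, MoveRight)) w.
Proof.
case: t => l h r [m] /= [_ ->]; case: w => [|b' w] /=; last by exists m.
by case: m => [|m]; [exists 1|exists m.+1].
Qed.

Lemma holds_push t w b : holds t w ->
  let t' := write_move t (tape_head t, MoveLeft) in
  holds (write_move t' (Some b, Stay)) (b :: w).
Proof. by case: t => l h r [m] /= E; exists m => /=; rewrite E. Qed.

Lemma upd_same s r w : upd s r w r = w. Proof. by rewrite /upd eqxx. Qed.

Lemma upd_other s r w x : x != r -> upd s r w x = s x.
Proof. by rewrite /upd => /negbTE ->. Qed.

Lemma pop_nil_step a r l1 l0 le cs s cf :
  subcode a (IPop r l1 l0 le :: cs) -> r < K.+1 -> le <= size code ->
  s r = [::] -> at_pc a s cf -> at_pc le s (@tm_step machine cf).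
Proof.
move=> /subcode_nth[Hi La] Lr Le Er [Ha Ht].
rewrite /= /tm_step /= Ha (ltn_eqF La) /instr_trans Ha Hi /=.
rewrite ffunE (holds_head (Ht _)) inordK // Er /=.
split=> [|i] /=; last by rewrite ffunE; apply: holds_stay.
by rewrite inordK.
Qed.

Lemma pop_step a r l1 l0 le cs s b w cf :
  subcode a (IPop r l1 l0 le :: cs) -> r < K.+1 -> l1 <= size code ->
  l0 <= size code -> s r = b :: w -> at_pc a s cf ->
  at_pc (if b then l1 else l0) (upd s r w) (@tm_step machine cf).
Proof.
move=> /subcode_nth[Hi La] Lr L1 L0 Er [Ha Ht].
rewrite /= /tm_step /= Ha (ltn_eqF La) /instr_trans Ha Hi /=.
rewrite ffunE (holds_head (Ht _)) inordK // Er /=.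
split=> [|i] /=; first by rewrite inordK //; case: (b).
rewrite !ffunE /upd; case: eqP => [Ei|_]; last exact: holds_stay.
by apply: (@holds_pop _ b); rewrite -Er -Ei.
Qed.

(** Induction on the run. The bodies of a loop are compiled with the address of the loop itself as
    their exit, so the induction hypothesis for the remaining turns applies at that same address. *)
Lemma simulate c a e s s' n cf :
  run c s s' n -> uses_below K.+1 c -> subcode a (compile c a e) ->
  e <= size code -> at_pc a s cf -> at_pc e s' (iter n (@tm_step machine) cf).
Proof.
move=> Hrun; elim: Hrun a e cf => {c s s' n}.
- move=> s a e cf _ /subcode_nth[Hi La] Le [Ha Ht].
  rewrite /= /tm_step /= Ha (ltn_eqF La) /instr_trans Ha Hi /=.
  split=> [|i] /=; first by rewrite inordK.
  by rewrite ffunE; apply: holds_stay.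
- move=> r b s a e cf /= Lr Sc Le [Ha Ht].
  have [Hi La] := subcode_nth Sc; have [Hi' La'] := subcode_nth (subcode_cons Sc).
  rewrite /= {2}/tm_step /= Ha (ltn_eqF La) /instr_trans Ha Hi /=.
  rewrite /tm_step /= /instr_trans inordK ?(ltn_eqF La') ?(ltnW La') // Hi' /=.
  split=> [|i] /=; first by rewrite inordK.
  rewrite !ffunE /upd; case: eqP => [Ei|_].
    have -> : inord r = i by apply: val_inj; rewrite /= inordK.
    by rewrite -Ei; apply: holds_push.
  by do 2!apply: holds_stay.
- move=> c d s1 s2 s3 m n _ IHc _ IHd a e cf /= /andP[Uc Ud] Sc Le At.
  rewrite addnC iterD; apply: (IHd (a + clen c)) => //.
    by have := subcode_catr Sc; rewrite size_compile.
  apply: (IHc a) => //; first exact: subcode_catl Sc.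
  have [pre [post [-> <-]]] := subcode_catl Sc.
  by rewrite !size_cat size_compile; lia.
- move=> r c1 c0 ce s s' n Er _ IH a e cf /= /and4P[Lr U1 U0 Ue] Sc Le At.
  have := subcode_cons Sc.
  move=> /subcode_catr; rewrite size_compile => /subcode_catr.
  rewrite size_compile => Se; rewrite -iterS iterSr.
  have Lae : a.+1 + clen c1 + clen c0 <= size code.
    by have [pre [post [-> <-]]] := Se; rewrite !size_cat; lia.
  exact: (IH _ _ _ _ _ _ (pop_nil_step Sc Lr Lae Er At)).
- move=> r c1 c0 ce s s' b w n Er _ IH a e cf /= /and4P[Lr U1 U0 Ue] Sc Le At.
  have S1 := subcode_catl (subcode_cons Sc).
  have := subcode_catr (subcode_cons Sc); rewrite size_compile => /subcode_catl S0.
  have La0 : a.+1 + clen c1 <= size code.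
    by have [pre [post [-> <-]]] := S0; rewrite !size_cat; lia.
  have La1 := leq_trans (leq_addr _ _) La0.
  have := pop_step Sc Lr La1 La0 Er At; rewrite -iterS iterSr.
  by case: b {Er} IH => IH /IH; apply.
- move=> r c1 c0 s Er a e cf /= /and3P[Lr U1 U0] Sc Le At.
  exact: (pop_nil_step Sc Lr Le Er At).
- move=> r c1 c0 s1 s2 s3 b w m n Er _ IHb _ IHl a e cf /= /and3P[Lr U1 U0] Sc Le.
  move=> At; have S1 := subcode_catl (subcode_cons Sc).
  have := subcode_catr (subcode_cons Sc); rewrite size_compile => S0.
  have La0 : a.+1 + clen c1 <= size code.
    by have [pre [post [-> <-]]] := S0; rewrite !size_cat; lia.
  have La1 := leq_trans (leq_addr _ _) La0.
  rewrite -iterS -addSn addnC iterD; apply: (IHl a) => //=; first by rewrite Lr U1 U0.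
  have := pop_step Sc Lr La1 La0 Er At; rewrite -iterS iterSr.
  by case: b {Er} IHb => IHb /IHb; apply=> //; apply: ltnW.
Qed.

End Machine.

Definition input_store (w : seq bool) : store := fun r => if r == 0 then w else [::].

(** Tape [r] carries stack [r]. A halted configuration no longer changes, so the run extends to any
    [T] above its length. *)
Theorem stack_program_machine (K : nat) (c : cmd) : uses_below K.+1 c ->
  exists M : turing_machine, forall w s' n T,
    run c (input_store w) s' n -> n <= T -> outputs_within M w (s' 0) T.
Proof.
move=> U; pose code := compile c 0 (clen c).
exists (machine K code) => w s' n T Hrun LT.
have Sc : subcode code 0 (compile c 0 (clen c)).
  by exists [::], [::]; rewrite cats0.
have Sz : size code = clen c by apply: size_compile.
have At0 : at_pc 0 (input_store w) (init_config (machine K code) w).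
  split=> [|i]; first by rewrite /= inordK.
  rewrite /= /input_store; have -> : (i == ord0) = (nat_of_ord i == 0) by [].
  by case: ifP => _; case: w {Hrun} => [|b w]; first [by exists 1 | by exists 0; rewrite /= cats0].
have := simulate Hrun U Sc _ At0; rewrite Sz => /(_ (leqnn _)) [Hq Ht].
rewrite /outputs_within -(subnK LT) iterD.
set cf := iter n _ _ in Hq Ht *.
have halt : tm_halting (cf_state cf) by rewrite /= Hq Sz.
have -> : iter (T - n) (@tm_step (machine K code)) cf = cf.
  by elim: (T - n) => //= j ->; rewrite /tm_step halt.
split=> //; have [m] := Ht ord0; rewrite /word_of_tape => ->.
by elim: (s' _) => [|b u IH] /=; [case: m | rewrite IH].
Qed.

(** * Running time of stack programs *)

Definition runs (c : cmd) (s s' : store) (B : nat) : Prop :=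
  exists2 n, n <= B & run c s s' n.

Lemma runs_le c s s' B B' : B <= B' -> runs c s s' B -> runs c s s' B'.
Proof. by move=> L [n Ln H]; exists n => //; apply: leq_trans L. Qed.

Lemma runs_then c d s1 s2 s3 B B' :
  runs c s1 s2 B -> runs d s2 s3 B' -> runs (Then c d) s1 s3 (B + B').
Proof. by move=> [m Lm Hm] [n Ln Hn]; exists (m + n); [lia | apply: RunThen Hm Hn]. Qed.

Lemma runs_skip s : runs Skip s s 1.
Proof. by exists 1 => //; apply: RunSkip. Qed.

Lemma runs_push r b s : runs (Push r b) s (upd s r (b :: s r)) 2.
Proof. by exists 2 => //; apply: RunPush. Qed.

Lemma runs_case r c1 c0 ce s s' b w B : s r = b :: w ->
  runs (if b then c1 else c0) (upd s r w) s' B ->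
  runs (Case r c1 c0 ce) s s' B.+1.
Proof. by move=> E [n Ln H]; exists n.+1 => //; apply: RunCase E H. Qed.

Lemma runs_case1 r c1 c0 ce s s' w B : s r = true :: w ->
  runs c1 (upd s r w) s' B -> runs (Case r c1 c0 ce) s s' B.+1.
Proof. exact: runs_case. Qed.

Lemma runs_case0 r c1 c0 ce s s' w B : s r = false :: w ->
  runs c0 (upd s r w) s' B -> runs (Case r c1 c0 ce) s s' B.+1.
Proof. exact: runs_case. Qed.

Lemma runs_loop_nil r c1 c0 s : s r = [::] -> runs (Loop r c1 c0) s s 1.
Proof. by move=> E; exists 1 => //; apply: RunLoopNil. Qed.

Lemma runs_loop_cons r c1 c0 s1 s2 s3 b w B B' : s1 r = b :: w ->
  runs (if b then c1 else c0) (upd s1 r w) s2 B ->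
  runs (Loop r c1 c0) s2 s3 B' -> runs (Loop r c1 c0) s1 s3 (B + B').+1.
Proof.
move=> E [m Lm Hm] [n Ln Hn]; exists (m + n).+1; first by lia.
exact: RunLoop E Hm Hn.
Qed.

Lemma runs_loop1 r c1 c0 s1 s2 s3 w B B' : s1 r = true :: w ->
  runs c1 (upd s1 r w) s2 B ->
  runs (Loop r c1 c0) s2 s3 B' -> runs (Loop r c1 c0) s1 s3 (B + B').+1.
Proof. exact: runs_loop_cons. Qed.

(* [st u v] is the store when [u] has been consumed and [v] remains. *)
Lemma runs_loop r c1 c0 (st : seq bool -> seq bool -> store) w B :
  (forall u b v, w = u ++ b :: v -> st u (b :: v) r = b :: v /\
     runs (if b then c1 else c0) (upd (st u (b :: v)) r v) (st (rcons u b) v) B) ->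
  st w [::] r = [::] ->
  runs (Loop r c1 c0) (st [::] w) (st w [::]) (size w * B.+1 + 1).
Proof.
move=> H E; suff G u v : w = u ++ v ->
    runs (Loop r c1 c0) (st u v) (st w [::]) (size v * B.+1 + 1) by apply: G.
elim: v u => [|b v IH] u Ew.
  by rewrite cats0 in Ew; rewrite -Ew; apply: runs_loop_nil.
have [E1 H1] := H _ _ _ Ew.
apply: runs_le (runs_loop_cons E1 H1 (IH _ _)); last by rewrite Ew cat_rcons.
by rewrite /=; lia.
Qed.

Ltac store_ext :=
  apply: functional_extensionality => ?; rewrite /upd;
  change (@rev bool [::]) with (@nil bool);
  repeat (case: eqP => [?|?] /=; try congruence); try congruence.

Fixpoint pushes (w : seq bool) : cmd :=
  if w is b :: w' then Then (pushes w') (Push 0 b) else Skip.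

Lemma upd_id s r : upd s r (s r) = s.
Proof. by store_ext. Qed.

Lemma runs_cast c s s1 s2 B B' :
  runs c s s1 B -> s1 = s2 -> B <= B' -> runs c s s2 B'.
Proof. by move=> H <- L; apply: runs_le H. Qed.

Lemma runs_pushes w s : runs (pushes w) s (upd s 0 (w ++ s 0)) (2 * size w + 1).
Proof.
elim: w => [|b w IH] /=; first by rewrite upd_id; apply: runs_skip.
apply: (runs_cast (runs_then IH (runs_push 0 b _))); last by lia.
by store_ext.
Qed.

(** * Writing words from templates *)

Inductive item : Type :=
| Lit of seq bool
| Map of nat & seq bool & seq bool.

(* Registers that are mapped hold their word in reverse, since emission goes
   from the last symbol to the first. *)
Definition interp (s : store) (it : item) : seq bool :=
  match it with
  | Lit w => w
  | Map r w1 w0 => flatten [seq if b then w1 else w0 | b <- rev (s r)]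
  end.

(** Reading a stack destroys it, so its bits are saved on stack 2 and put back afterwards; the two
    reversals cancel. *)
Definition emit_item (it : item) : cmd :=
  match it with
  | Lit w => pushes w
  | Map r w1 w0 =>
      Then (Loop r (Then (Push 2 true) (pushes w1))
                   (Then (Push 2 false) (pushes w0)))
           (Loop 2 (Push r true) (Push r false))
  end.

Definition item_cost (it : item) : nat :=
  match it with
  | Lit w => 2 * size w + 1
  | Map _ w1 w0 => 2 * (size w1 + size w0) + 10
  end.

Definition item_ok (it : item) : bool :=
  if it is Map r _ _ then (r != 0) && (r != 2) else true.

Definition item_le (s : store) (S : nat) (it : item) : bool :=
  if it is Map r _ _ then size (s r) <= S else true.

Lemma runs_emit_item it s S : item_ok it -> s 2 = [::] -> item_le s S it ->
  runs (emit_item it) s (upd s 0 (interp s it ++ s 0)) (item_cost it * S.+1).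
Proof.
case: it => [w _ _ _|r w1 w0 /= /andP[r0 r2] E2 LS] /=.
  by apply: runs_le (runs_pushes w s); rewrite leq_pmulr.
pose wb (b : bool) := if b then w1 else w0.
pose st u v := upd (upd (upd s r v) 2 (rev u)) 0 (flatten [seq wb b | b <- rev u] ++ s 0).
pose st2 (s : store) u v := upd (upd s 2 v) r (rev u).
set w := s r.
have H1 := @runs_loop r (Then (Push 2 true) (pushes w1))
  (Then (Push 2 false) (pushes w0)) st w (2 * (size w1 + size w0) + 3).
have H2 := @runs_loop 2 (Push r true) (Push r false) (st2 (st w [::])) (rev w) 2.
have n2r : (2 == r) = false by rewrite eq_sym (negbTE r2).
have nr0 : r <> 0 by apply/eqP.
have nr2 : r <> 2 by apply/eqP.
have Es : st [::] w = s by rewrite /st /w; store_ext.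
have Es2 : st2 (st w [::]) [::] (rev w) = st w [::] by rewrite /st2 /st; store_ext.
rewrite Es in H1; rewrite Es2 in H2.
apply: (runs_cast (runs_then (H1 _ _) (H2 _ _))).
- move=> u b v _; split; first by rewrite /st /upd (negbTE r0) (negbTE r2) eqxx.
  apply: (@runs_cast _ _ (upd (upd (upd (st u (b :: v)) r v) 2 (b :: rev u)) 0
     (wb b ++ st u (b :: v) 0)) _ (2 + (2 * size (wb b) + 1))).
  + case: b; apply: (runs_cast (runs_then (runs_push _ _ _) (runs_pushes _ _))) => //=.
    * rewrite /st; store_ext.
    * rewrite /st; store_ext.
  + rewrite /st rev_rcons /=; store_ext; by rewrite -catA.
  + by case: (b) => /=; lia.
- by rewrite /st /upd (negbTE r0) (negbTE r2) eqxx.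
- move=> u b v _; split; first by rewrite /st2 /upd n2r.
  by case: b; apply: (runs_cast (runs_push _ _ _)) => //; rewrite /st2 rev_rcons; store_ext.
- by rewrite /st2 /upd n2r.
- by rewrite /st2 /st revK /w /wb; store_ext.
rewrite size_rev -/w in LS *; nia.
Qed.

Fixpoint emit (its : seq item) : cmd :=
  if its is it :: its' then Then (emit its') (emit_item it) else Skip.

Definition items_cost (its : seq item) : nat := (sumn (map item_cost its)).+1.

Definition interps (s : store) (its : seq item) : seq bool :=
  flatten (map (interp s) its).

Lemma runs_emit its s S : all item_ok its -> s 2 = [::] -> all (item_le s S) its ->
  runs (emit its) s (upd s 0 (interps s its ++ s 0)) (items_cost its * S.+1).
Proof.
move=> + E2; elim: its => [|it its IH] /=.
  by move=> _ _; rewrite upd_id; apply: runs_le (runs_skip s); rewrite mul1n.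
move=> /andP[ok1 ok] /andP[le1 le]; have {}IH := IH ok le.
set s1 := upd _ _ _ in IH.
have Ei : interp s1 it = interp s it.
  by case: (it) ok1 => //= r w1 w0 /andP[r0 _]; rewrite /s1 /upd (negbTE r0).
have L1 : item_le s1 S it.
  by case: (it) ok1 le1 => //= r w1 w0 /andP[r0 _]; rewrite /s1 /upd (negbTE r0).
have E2' : s1 2 = [::] by [].
apply: (runs_cast (runs_then IH (runs_emit_item ok1 E2' L1))).
  by rewrite Ei /s1 /interps /= -catA; store_ext.
by rewrite /items_cost /=; lia.
Qed.

(** * Copying, clearing and parsing *)

Definition copy (r d : nat) : cmd :=
  Then (Loop r (Push 2 true) (Push 2 false))
       (Loop 2 (Then (Push r true) (Push d true)) (Then (Push r false) (Push d false))).

Lemma runs_drain r d s w : r <> d -> s r = w ->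
  runs (Loop r (Push d true) (Push d false)) s
       (upd (upd s r [::]) d (rev w ++ s d)) (size w * 3 + 1).
Proof.
move=> rd Er; pose st u v := upd (upd s r v) d (rev u ++ s d).
have rdF : (r == d) = false by apply/eqP.
have Es : st [::] w = s by rewrite /st; store_ext.
rewrite -{1}Es; apply: runs_loop; last by rewrite /st /upd rdF eqxx.
move=> u b v _; split; first by rewrite /st /upd rdF eqxx.
by case: b; apply: (runs_cast (runs_push _ _ _)) => //; rewrite /st rev_rcons; store_ext.
Qed.

Lemma runs_copy r d s : r <> 2 -> d <> 2 -> r <> d -> s 2 = [::] ->
  s d = [::] -> runs (copy r d) s (upd s d (s r)) (8 * size (s r) + 2).
Proof.
move=> r2 d2 rd E2 Ed; have := runs_drain r2 (erefl (s r)).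
set w := s r; set s1 := upd _ _ _ => H1.
pose st u v := upd (upd (upd s1 2 v) r (rev u)) d (rev u).
have n2r : (2 == r) = false by rewrite eq_sym; apply/eqP.
have n2d : (2 == d) = false by rewrite eq_sym; apply/eqP.
have H2 := @runs_loop 2 (Then (Push r true) (Push d true))
  (Then (Push r false) (Push d false)) st (rev w) 4.
have Es : st [::] (rev w) = s1 by rewrite /st /s1 E2 cats0; store_ext.
rewrite Es in H2; apply: (runs_cast (runs_then H1 (H2 _ _))).
- move=> u b v _; split; first by rewrite /st /upd n2r n2d eqxx.
  case: b; apply: (runs_cast (runs_then (runs_push _ _ _) (runs_push _ _ _))) => //;
  by rewrite /st rev_rcons; store_ext.
- by rewrite /st /upd n2r n2d eqxx.
- by rewrite /st /s1 /w revK; store_ext.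
- by rewrite size_rev; lia.
Qed.

Definition clear (r : nat) : cmd := Loop r Skip Skip.

Lemma runs_clear r s S : size (s r) <= S ->
  runs (clear r) s (upd s r [::]) (2 * S + 1).
Proof.
move=> LS; have H := @runs_loop r Skip Skip (fun _ v => upd s r v) (s r) 1.
rewrite upd_id in H; apply: runs_le (H _ _); first by lia.
  move=> u b v _; split; first by rewrite /upd eqxx.
  by case: b; apply: (runs_cast (runs_skip _)) => //; store_ext.
by rewrite /upd eqxx.
Qed.

Definition pop_bit (r d : nat) : cmd := Case r (Push d true) (Push d false) Skip.

Lemma runs_pop_bit r d s b w : s r = b :: w ->
  runs (pop_bit r d) s (upd (upd s r w) d (b :: upd s r w d)) 3.
Proof.
by move=> E; rewrite /pop_bit; apply: (runs_case _ E); case: b {E}; apply: runs_push.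
Qed.

(* Stack 16 holds a bit as long as there are digits to read. *)
Definition parse_nat (r d : nat) : cmd :=
  Then (Push 16 true)
    (Loop 16
      (Case r
        (Then (Push d true)
          (Then (Case r (Push d true) (Push d false) Skip) (Push 16 true)))
        (Push d false) Skip)
      Skip).

(** The digits move one by one from [r] to [d] and so arrive in reverse, which is the form that
    [Map] expects. *)
Lemma runs_parse_nat r d s n w : r <> 16 -> d <> 16 -> r <> d ->
  s 16 = [::] -> s r = enc_nat n ++ w ->
  runs (parse_nat r d) s (upd (upd s r w) d (rev (enc_nat n) ++ s d))
    (10 * size (enc_nat n) + 10).
Proof.
move=> r16 d16 rd E16; rewrite /enc_nat -/(announce _); move: (nat_bits n) => u Er.
suff H s0 : s0 16 = [:: true] -> s0 r = (announce u ++ [:: false]) ++ w ->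
   runs (Loop 16
      (Case r
        (Then (Push d true)
          (Then (Case r (Push d true) (Push d false) Skip) (Push 16 true)))
        (Push d false) Skip)
      Skip) s0 (upd (upd (upd s0 16 [::]) r w) d (rev (announce u ++ [:: false]) ++ s0 d))
     (10 * size (announce u) + 10).
  apply: (runs_cast (runs_then (runs_push 16 true s) (H _ _ _))).
  - by rewrite /upd E16.
  - by rewrite /upd; case: eqP.
  - by store_ext.
  - by rewrite size_cat /=; lia.
have n16r : (16 == r) = false by rewrite eq_sym; apply/eqP.
have n16d : (16 == d) = false by rewrite eq_sym; apply/eqP.
have nr16 : (r == 16) = false by apply/eqP.
have nd16 : (d == 16) = false by apply/eqP.
have nrd : (r == d) = false by apply/eqP.
have ndr : (d == r) = false by rewrite eq_sym.
elim: u s0 {Er} => [|b u IH] s0 E0 /= Er.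
  have E1 : upd s0 16 [::] r = false :: w by rewrite /upd nr16.
  apply: (runs_cast (runs_loop1 E0 (runs_case0 _ _ E1 (runs_push d false _))
    (runs_loop_nil _ _ _))) => //.
  - by rewrite /upd n16d n16r.
  - by rewrite /announce /=; store_ext.
have E1 : upd s0 16 [::] r = [:: true, b & (announce u ++ [:: false]) ++ w].
  by rewrite /upd nr16.
set w1 := b :: _ in E1.
have E2 : upd (upd (upd s0 16 [::]) r w1) d (true :: s0 d) r = w1.
  by rewrite /upd nrd eqxx.
pose s1 := upd (upd (upd s0 16 [:: true]) r ((announce u ++ [:: false]) ++ w)) d
  [:: b, true & s0 d].
have H1 : s1 16 = [:: true] by rewrite /s1 /upd n16d n16r.
have H2 : s1 r = (announce u ++ [:: false]) ++ w by rewrite /s1 /upd nrd eqxx.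
have {}IH := IH s1 H1 H2.
apply: (runs_cast (runs_loop1 E0 (runs_case1 _ _ E1 (B := 2 + (3 + 2)) _) IH)); last first.
- by rewrite /announce /= -/(announce u); lia.
- by rewrite /s1 !rev_cons -!cats1 -!catA /upd eqxx; store_ext.
- apply: (@runs_then _ _ _ (upd (upd (upd s0 16 [::]) r w1) d (true :: s0 d))).
    by apply: (runs_cast (runs_push _ _ _)) => //; rewrite /upd ndr nd16.
  apply: (runs_then (s2 := upd (upd (upd s0 16 [::]) r
     ((announce u ++ [:: false]) ++ w)) d [:: b, true & s0 d])).
    apply: (runs_cast (runs_pop_bit d E2)) => //.
    by store_ext.
  by apply: (runs_cast (runs_push _ _ _)) => //; rewrite /s1; store_ext.
Qed.

Ltac neqs :=
  repeat match goal with
  | H : ?x <> ?y |- context [?x == ?y] => rewrite (introF (@eqP _ x y) H)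
  | H : ?x <> ?y |- context [?y == ?x] =>
      rewrite (introF (@eqP _ y x) (not_eq_sym H))
  end; rewrite ?eqxx.

Definition parse_atom (A TI I TJ J C : nat) : cmd :=
  Then (pop_bit A TI) (Then (parse_nat A I) (Then (pop_bit A TJ)
    (Then (parse_nat A J) (Then (pop_bit A C) (parse_nat A C))))).

Lemma enc_datomE (N : nat) (a : datom N) w :
  enc_datom a ++ w = dvar_tag (d_pos a) :: enc_nat (dvar_index (d_pos a)) ++
    dvar_tag (d_neg a) :: enc_nat (dvar_index (d_neg a)) ++
    (d_bound a < 0)%R :: enc_nat `|d_bound a|%N ++ w.
Proof.
rewrite /enc_datom !enc_dvarE /enc_int.
do 3!move: (enc_nat _) => ?.
by rewrite !cat_cons -!catA !cat_cons -!catA.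
Qed.

Lemma runs_parse_atom (N : nat) (a : datom N) A TI I TJ J C s w :
  uniq [:: A; TI; I; TJ; J; C; 16] -> s 16 = [::] ->
  s TI = [::] -> s I = [::] -> s TJ = [::] -> s J = [::] -> s C = [::] ->
  s A = enc_datom a ++ w ->
  runs (parse_atom A TI I TJ J C) s
    (upd (upd (upd (upd (upd (upd s A w)
       TI [:: dvar_tag (d_pos a)]) I (rev (enc_nat (dvar_index (d_pos a)))))
       TJ [:: dvar_tag (d_neg a)]) J (rev (enc_nat (dvar_index (d_neg a)))))
       C (rev (enc_int (d_bound a))))
    (10 * size (enc_datom a) + 40).
Proof.
rewrite /= !inE !negb_or -!andbA.
do 21!(case/andP=> /eqP ?); move=> _ E16 ETI EI ETJ EJ EC.
rewrite enc_datomE /enc_int => EA.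
have := enc_datomE a [::]; rewrite !cats0 => ->.
set ti := dvar_tag _ in EA *; set i := nat_of_ord _ in EA *.
set tj := dvar_tag _ in EA *; set j := nat_of_ord (dvar_index (d_neg a)) in EA *.
set c := absz _ in EA *; set sg := (_ < _)%R in EA *.
set w1 := enc_nat i ++ _ in EA.
pose w2 := tj :: enc_nat j ++ sg :: enc_nat c ++ w.
pose w3 := enc_nat j ++ sg :: enc_nat c ++ w.
pose w4 := sg :: enc_nat c ++ w.
pose w5 := enc_nat c ++ w.
pose s1 := upd (upd s A w1) TI [:: ti].
pose s2 := upd (upd s1 A w2) I (rev (enc_nat i)).
pose s3 := upd (upd s2 A w3) TJ [:: tj].
pose s4 := upd (upd s3 A w4) J (rev (enc_nat j)).
pose s5 := upd (upd s4 A w5) C [:: sg].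
have lk x : s1 x = if x == TI then [:: ti] else if x == A then w1 else s x by [].
have lk2 x : s2 x = if x == I then rev (enc_nat i) else if x == A then w2 else s1 x by [].
have lk3 x : s3 x = if x == TJ then [:: tj] else if x == A then w3 else s2 x by [].
have lk4 x : s4 x = if x == J then rev (enc_nat j) else if x == A then w4 else s3 x by [].
have lk5 x : s5 x = if x == C then [:: sg] else if x == A then w5 else s4 x by [].
have R1 : runs (pop_bit A TI) s s1 3.
  by apply: (runs_cast (runs_pop_bit TI EA)) => //; rewrite /s1; store_ext.
have R2 : runs (parse_nat A I) s1 s2 (10 * size (enc_nat i) + 10).
  have s1I : s1 I = [::] by rewrite lk; neqs.
  have := @runs_parse_nat A I s1 i w2; rewrite s1I cats0; apply=> //.
    by rewrite lk; neqs.
  by rewrite lk; neqs.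
have R3 : runs (pop_bit A TJ) s2 s3 3.
  have s2A : s2 A = tj :: w3 by rewrite lk2; neqs.
  apply: (runs_cast (runs_pop_bit TJ s2A)) => //.
  by rewrite [upd s2 A w3 TJ]/upd lk2 lk; neqs; rewrite ETJ.
have R4 : runs (parse_nat A J) s3 s4 (10 * size (enc_nat j) + 10).
  have s3J : s3 J = [::] by rewrite lk3 lk2 lk; neqs.
  have := @runs_parse_nat A J s3 j w4; rewrite s3J cats0; apply=> //.
    by rewrite lk3 lk2 lk; neqs.
  by rewrite lk3; neqs.
have R5 : runs (pop_bit A C) s4 s5 3.
  have s4A : s4 A = sg :: w5 by rewrite lk4; neqs.
  apply: (runs_cast (runs_pop_bit C s4A)) => //.
  by rewrite [upd s4 A w5 C]/upd lk4 lk3 lk2 lk; neqs; rewrite EC.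
have R6 : runs (parse_nat A C) s5 (upd (upd s5 A w) C (rev (sg :: enc_nat c)))
    (10 * size (enc_nat c) + 10).
  have s5C : s5 C = [:: sg] by rewrite lk5; neqs.
  have := @runs_parse_nat A C s5 c w; rewrite s5C cats1 -rev_cons; apply=> //.
    by rewrite lk5 lk4 lk3 lk2 lk; neqs.
  by rewrite lk5; neqs.
apply: (runs_cast (runs_then R1 (runs_then R2 (runs_then R3 (runs_then R4
  (runs_then R5 R6)))))).
  by rewrite /s5 /s4 /s3 /s2 /s1; store_ext.
by rewrite /= size_cat /= size_cat /=; lia.
Qed.

Definition clears (rs : seq nat) : cmd := foldr (fun r => Then (clear r)) Skip rs.

Lemma runs_clears rs s S : (forall r, r \in rs -> size (s r) <= S) ->
  runs (clears rs) s (fun x => if x \in rs then [::] else s x)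
    (size rs * (2 * S + 1) + 1).
Proof.
elim: rs s => [|r rs IH] s H /=; first exact: runs_skip.
have Hr : size (s r) <= S by apply: H; rewrite mem_head.
apply: (runs_cast (runs_then (runs_clear Hr) (IH _ _))).
- move=> x Hx; rewrite /upd; case: eqP => // _.
  by apply: H; rewrite inE Hx orbT.
- apply: functional_extensionality => x; rewrite /upd inE.
  by case: eqP => //= _; case: ifP.
- by rewrite mulSn addnA.
Qed.

(** * Loops over the symbols and the atoms of the input *)

Definition same_except (rs : seq nat) (s s' : store) : Prop :=
  forall x, x \notin rs -> s' x = s x.

(** Only the length of [X] matters. The unary counter [K] is incremented by the body: before its
    work for cycle lengths, which start at 1, and after it for times, which start at 0. *)
Definition each_bit (X D K : nat) (body : cmd) : cmd :=
  Then (copy X D) (Then (Loop D body body) (clear K)).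

Lemma runs_each_bit X D K body (f : nat -> seq bool -> seq bool) s B :
  uniq [:: 0; 2; X; D; K] -> s 2 = [::] -> s D = [::] -> s K = [::] ->
  (forall j s', j < size (s X) -> same_except [:: 0; D; K] s s' ->
     s' K = nseq j true ->
     runs body s' (upd (upd s' K (nseq j.+1 true)) 0 (f j (s' 0))) B) ->
  runs (each_bit X D K body) s
    (upd s 0 (foldl (fun acc j => f j acc) (s 0) (iota 0 (size (s X)))))
    (size (s X) * (B + 11) + 4).
Proof.
rewrite /= !inE !negb_or -!andbA.
do 10!(case/andP=> /eqP ?); move=> _ E2 ED EK Hbody.
have H1 := @runs_copy X D s; set w := s X in H1 Hbody *.
pose acc (u : seq bool) := foldl (fun acc j => f j acc) (s 0) (iota 0 (size u)).
pose st u v := upd (upd (upd s D v) K (nseq (size u) true)) 0 (acc u).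
have H2 := @runs_loop D body body st w B.
have Es : st [::] w = upd s D w by rewrite /st /acc /=; store_ext.
rewrite Es in H2; have H3 := @runs_clear K (st w [::]) (size w).
apply: (runs_cast (runs_then (H1 _ _ _ _ _) (runs_then (H2 _ _) (H3 _)))) => //; try congruence.
- move=> u b v Ew; split; first by rewrite /st /upd; neqs.
  rewrite if_same; apply: (runs_cast (Hbody (size u) _ _ _ _)) => //.
  + by rewrite Ew size_cat /=; lia.
  + move=> x; rewrite !inE !negb_or => /and3P[/eqP ? /eqP ? /eqP ?].
    by rewrite /st /upd; neqs.
  + by rewrite /st /upd; neqs.
  + rewrite [upd (st _ _) D v 0]/upd; neqs; rewrite {2}/st [upd _ 0 _ 0]/upd eqxx.
    rewrite /st size_rcons /acc size_rcons -addn1 iotaD foldl_cat /= addn1 add0n.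
    by store_ext.
- by rewrite /st /upd; neqs.
- by rewrite /st /upd; neqs; rewrite size_nseq.
- by rewrite /st /acc /=; store_ext.
- by lia.
Qed.

(** The 1 that announces an atom is consumed by the loop test; the final 0 of the list leads to
    [Skip] and leaves [A] empty. *)
Definition each_atom (A TI I TJ J C : nat) (body : cmd) : cmd :=
  Then (copy 1 A)
    (Loop A (Then (parse_atom A TI I TJ J C)
      (Then body (clears [:: TI; I; TJ; J; C]))) Skip).

Lemma enc_datom_parts (N : nat) (a : datom N) :
  [/\ size (enc_nat (dvar_index (d_pos a))) <= size (enc_datom a),
      size (enc_nat (dvar_index (d_neg a))) <= size (enc_datom a) &
      size (enc_int (d_bound a)) <= size (enc_datom a)].
Proof.
have := enc_datomE a [::]; rewrite !cats0 => ->; rewrite /enc_int.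
do 3!move: (enc_nat _) => ?.
by split; do 4!rewrite ?size_cat /=; clear; lia.
Qed.

Lemma size_enc_datom (N : nat) (R : dbc N) a : a \in R ->
  size (enc_datom a) < size (enc_dbc R).
Proof.
rewrite /enc_dbc size_cat addn1 ltnS; elim: R => //= b R IH.
by rewrite inE size_cat => /predU1P[->|/IH]; lia.
Qed.

(** Seven bits per atom: its announcement, two tags, a sign, and at least the closing 0 of each of
    three numbers. *)
Lemma size_dbc (N : nat) (R : dbc N) : 7 * size R < size (enc_dbc R).
Proof.
rewrite /enc_dbc size_cat addn1 ltnS; elim: R => //= a R IH.
have := enc_datomE a [::]; rewrite cats0 => ->.
have e n : 0 < size (enc_nat n) by rewrite size_cat addn1.
move: (enc_nat _) (e (dvar_index (d_pos a))) => u1 h1.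
move: (enc_nat _) (e (dvar_index (d_neg a))) => u2 h2.
move: (enc_nat _) (e `|d_bound a|%N) => u3 h3.
by rewrite cats0; do 4!rewrite ?size_cat /=; lia.
Qed.

Lemma runs_each_atom (N : nat) (R : dbc N) A TI I TJ J C body
    (f : datom N -> seq bool -> seq bool) s B :
  uniq [:: A; TI; I; TJ; J; C; 16; 0; 1; 2] -> s 1 = enc_dbc R ->
  s 16 = [::] -> s 2 = [::] -> s A = [::] ->
  s TI = [::] -> s I = [::] -> s TJ = [::] -> s J = [::] -> s C = [::] ->
  (forall a s', a \in R -> same_except [:: 0; A; TI; I; TJ; J; C] s s' ->
     s' TI = [:: dvar_tag (d_pos a)] -> s' I = rev (enc_nat (dvar_index (d_pos a))) ->
     s' TJ = [:: dvar_tag (d_neg a)] -> s' J = rev (enc_nat (dvar_index (d_neg a))) ->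
     s' C = rev (enc_int (d_bound a)) ->
     runs body s' (upd s' 0 (f a (s' 0))) B) ->
  runs (each_atom A TI I TJ J C body) s
    (upd s 0 (foldl (fun acc a => f a acc) (s 0) R))
    (size (enc_dbc R) * (B + 20 * size (enc_dbc R) + 60) + 10).
Proof.
move=> U E1 E16 E2 EA ETI EI ETJ EJ EC Hbody.
have U7 : uniq [:: A; TI; I; TJ; J; C; 16].
  by move: U; rewrite -[[:: A, TI & _]]/([:: A; TI; I; TJ; J; C; 16] ++ [:: 0; 1; 2])
     cat_uniq => /andP[].
move: U; rewrite /= !inE !negb_or -!andbA.
do ?[case/andP=> /eqP ?]; move=> _.
set M := size (enc_dbc R).
have H1 := @runs_copy 1 A s; rewrite E1 -/M in H1.
pose acc := foldl (fun acc a => f a acc).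
pose st z (v : dbc N) := upd (upd s A (enc_dbc v)) 0 z.
pose P := Then (parse_atom A TI I TJ J C) (Then body (clears [:: TI; I; TJ; J; C])).
have loop v z : {subset v <= R} ->
    runs (Loop A P Skip) (st z v) (upd s 0 (acc z v))
      (size v * (B + 20 * M + 52) + 3).
  elim: v z => [|a v IH] z sub.
    have EA' : st z [::] A = [:: false] by rewrite /st /upd; neqs.
    apply: (runs_cast (runs_loop_cons EA' (runs_skip _) (runs_loop_nil _ _ _))) => //.
      by rewrite /upd eqxx.
    by rewrite /st /acc /=; store_ext.
  have aR : a \in R by apply: sub; rewrite mem_head.
  have EA' : st z (a :: v) A = true :: enc_datom a ++ enc_dbc v.
    by rewrite /st /upd; neqs; rewrite /enc_dbc /= -catA.
  pose s0 := upd (st z (a :: v)) A (enc_datom a ++ enc_dbc v).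
  have s0E x : x <> 0 -> x <> A -> s0 x = s x.
    by move=> ? ?; rewrite /s0 /st /upd; neqs.
  have H2 := @runs_parse_atom N a A TI I TJ J C s0 (enc_dbc v) U7.
  set s2 := upd _ C _ in H2.
  have H3 := Hbody a s2 aR.
  have s20 : s2 0 = z by rewrite /s2 /s0 /st /upd; neqs.
  set s3 := upd s2 0 _ in H3.
  have H4 := @runs_clears [:: TI; I; TJ; J; C] s3 M.
  have subv : {subset v <= R} by move=> x Hx; apply: sub; rewrite inE Hx orbT.
  have {}IH := IH (f a z) subv.
  have Es3 : (fun x => if x \in [:: TI; I; TJ; J; C] then [::] else s3 x) =
      st (f a z) v.
    rewrite /s3 s20 /s2 /s0 /st; apply: functional_extensionality => x.
    rewrite /upd !inE.
    by repeat (case: eqP => [?|?] /=; try congruence); try congruence.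
  rewrite Es3 in H4.
  have sz := size_enc_datom aR.
  have [bi bj bc] := enc_datom_parts a.
  have {}bi := leq_trans bi (ltnW sz); have {}bj := leq_trans bj (ltnW sz).
  have {}bc := leq_trans bc (ltnW sz).
  have M0 : 0 < M by apply: leq_ltn_trans sz.
  have body_ok : runs P s0 (st (f a z) v) ((10 * M + 40) + (B + (5 * (2 * M + 1) + 1))).
    apply: (@runs_then _ _ _ s2).
      apply: (runs_cast (H2 _ _ _ _ _ _ _)) => //;
        try by (rewrite s0E //; congruence).
        by rewrite /s0 upd_same.
      by rewrite leq_add2r leq_mul2l (ltnW sz).
    apply: runs_then.
      apply: H3.
      + move=> x; rewrite !inE !negb_or.
        do 6!(case/andP=> /eqP ?); move/eqP=> ?.
        by rewrite /s2 /s0 /st /upd; neqs.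
      + by rewrite /s2 /upd; neqs.
      + by rewrite /s2 /upd; neqs.
      + by rewrite /s2 /upd; neqs.
      + by rewrite /s2 /upd; neqs.
      + by rewrite /s2 /upd; neqs.
    apply: H4 => r; rewrite !inE.
    case/or4P=> [/eqP->|/eqP->|/eqP->|/orP[/eqP->|/eqP->]]; rewrite /s3 /s2 /upd; neqs;
      by rewrite ?size_rev.
  apply: (runs_cast (runs_loop1 EA' body_ok IH)) => //.
  by rewrite /=; lia.
have sR := size_dbc R; rewrite -/M in sR.
have Es : st (s 0) R = upd s A (enc_dbc R) by rewrite /st; store_ext.
have := loop R (s 0) (fun x Hx => Hx); rewrite Es => {}loop.
apply: (runs_cast (runs_then (H1 _ _ _ _ _) loop)) => //; try congruence.
have RM : size R <= M by move: sR; clear; lia.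
have -> : B + 20 * M + 60 = B + 20 * M + 52 + 8 by rewrite -[RHS]addnA.
rewrite [M * _]mulnDr [M * 8]mulnC.
have := leq_mul RM (leqnn (B + 20 * M + 52)).
move: (B + _ + _) => X; move: (size R * X) (M * X) => x y; clear; lia.
Qed.

(** * The program that writes the formula *)

(* Registers: 1 the input, 3 the unary bound T, 5 the cycle length, 7 the pivot,
   9 the time, and for the current atom 11 and 12 the two indices, 14 and 15
   their tags, 13 the bound. *)
Definition plain (r : nat) : item := Map r [:: true] [:: false].
(** Inserts the announcing 1 before each bit, as required inside a name. *)
Definition doubled (r : nat) : item := Map r [:: true; true] [:: true; false].

Definition tsel_items (s : tsel) : seq item :=
  match s with
  | AtZero => [::]
  | AtL => [:: doubled 5]
  | AtT => [:: doubled 9]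
  | AtTS => [:: Lit [:: true; true]; doubled 9]
  end.

Definition vsel_reg (s : vsel) : nat :=
  match s with SrcV => 11 | DstV => 12 | PivotV => 7 end.

(** Register 1 stands for [M] because the input has length [M]. *)
Definition numsel_reg (s : numsel) : nat :=
  match s with NumBound => 3 | NumSize => 1 | NumT => 9 end.

Definition name_items (f : auxkind) (t : tsel) (v : vsel) : seq item :=
  [:: Lit (announce (auxkind_bits f)), doubled 5, Lit [:: true; false],
      doubled 7 & tsel_items t ++
      [:: Lit [:: true; false]; doubled (vsel_reg v); Lit [:: true; true; false]]].

(** The encoding of the prefix [PAdd (PConst 1)]. *)
Definition succ_word : seq bool := [:: true; false; false; true] ++ enc_int 1.

Fixpoint term_items (s : sterm) : seq item :=
  match s with
  | SAux f t v => Lit [:: false; false; true] :: name_items f t v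
  | SIter => [:: Lit [:: false; false; false; false]]
  | SPos => [:: Lit [:: false; false; false; true]; plain 14; plain 11]
  | SNeg => [:: Lit [:: false; false; false; true]; plain 15; plain 12]
  | SNum n => [:: Map (numsel_reg n) succ_word succ_word;
                  Lit ([:: false; true] ++ enc_int 0)]
  | SConst c => [:: Lit ([:: false; true] ++ enc_int c)]
  | SAdd s1 s2 => Lit [:: true; false] :: term_items s1 ++ term_items s2
  | SBound => [:: Lit [:: false; true]; plain 13]
  | SScale s1 => [:: Lit [:: true; true], plain 13 & term_items s1]
  end.

Fixpoint form_items (s : sform) : seq item :=
  match s with
  | SLe s1 s2 =>
      Lit [:: false; false; false] :: term_items s1 ++ term_items s2
  | SEq s1 s2 =>
      Lit [:: false; false; true] :: term_items s1 ++ term_items s2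
  | SNot s1 => Lit [:: false; true; false] :: form_items s1
  | SAnd s1 s2 => Lit [:: false; true; true] :: form_items s1 ++ form_items s2
  | SOr s1 s2 => Lit [:: true; false; false] :: form_items s1 ++ form_items s2
  end.

Definition block_items : seq item := Lit [:: false; true; true] :: form_items block.

Definition names_items : seq item :=
  flatten [seq Lit [:: true; false; true] :: name_items p.1.1 p.1.2 p.2
          | p <- form_auxs block].

Lemma interps_cat s its its' :
  interps s (its ++ its') = interps s its ++ interps s its'.
Proof. by rewrite /interps map_cat flatten_cat. Qed.

Lemma interps_cons s it its : interps s (it :: its) = interp s it ++ interps s its.
Proof. by []. Qed.

Lemma flatten_singletons (u : seq bool) :
  flatten [seq if b then [:: true] else [:: false] | b <- u] = u.
Proof. by elim: u => //= b u ->; case: b. Qed.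

Lemma flatten_announce (u : seq bool) :
  flatten [seq if b then [:: true; true] else [:: true; false] | b <- u] = announce u.
Proof. by elim: u => //= b u ->; case: b. Qed.

Section Represents.
Variables (N M T : nat).

Definition represents (s : store) (x : point N) : Prop :=
  [/\ [/\ size (s 1) = M, s 3 = nseq T true & s 5 = nseq (pt_len x) true],
      s 7 = rev (enc_nat (pt_pivot x)), s 9 = nseq (pt_time x) true,
      [/\ s 11 = rev (enc_nat (dvar_index (d_pos (pt_atom x)))),
          s 12 = rev (enc_nat (dvar_index (d_neg (pt_atom x)))) &
          s 13 = rev (enc_int (d_bound (pt_atom x)))] &
      s 14 = [:: dvar_tag (d_pos (pt_atom x))] /\
      s 15 = [:: dvar_tag (d_neg (pt_atom x))]].

Variables (s : store) (x : point N).
Hypothesis sx : represents s x.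

Lemma interp_plain r u : s r = rev u -> interp s (plain r) = u.
Proof. by move=> /= ->; rewrite revK flatten_singletons. Qed.

Lemma interp_doubled r u : s r = rev u -> interp s (doubled r) = announce u.
Proof. by move=> /= ->; rewrite revK flatten_announce. Qed.

Lemma interps_name f t v : interps s (name_items f t v) = enc_nat (name (key x f t v)).
Proof.
case: sx => -[_ _ E5] E7 E9 [E11 E12 _] _.
have Ev : s (vsel_reg v) = rev (enc_nat (vsel_val x v)) by case: v.
have E5' : s 5 = rev (nseq (pt_len x) true) by rewrite rev_nseq.
have E9' : s 9 = rev (nseq (pt_time x) true) by rewrite rev_nseq.
have Et : interps s (tsel_items t) = announce (nseq (tsel_val x t) true).
  case: t; rewrite //= ?interps_cons ?(interp_doubled E5') ?(interp_doubled E9') /interps /= ?cats0 //.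
rewrite /name enc_bits_nat /name_bits /key /name_items.
rewrite !(interps_cons, interps_cat) (interp_doubled E5') (interp_doubled E7) Et
  (interp_doubled Ev).
move: (enc_nat (pt_pivot x)) (enc_nat (vsel_val x v)) => p q.
by rewrite -[false :: p ++ _]cat1s -[false :: q]cat1s !announce_cat -!catA.
Qed.

Lemma enc_numeral n : enc_pterm (numeral N n) =
  flatten (nseq n succ_word) ++ [:: false; true] ++ enc_int 0.
Proof. by elim: n => //= n ->. Qed.

Lemma interps_term t : interps s (term_items t) = enc_pterm (term_of M T x t).
Proof.
case: (sx) => -[E1 E3 E5] E7 E9 [E11 E12 E13] [E14 E15].
elim: t => [f t v||||n|c|t1 IH1 t2 IH2||t IH].
- by rewrite /= interps_cons interps_name.
- by [].
- by rewrite /= !interps_cons (interp_plain (u := [:: _]) E14) (interp_plain E11) /interps /= cats0 enc_dvarE.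
- by rewrite /= !interps_cons (interp_plain (u := [:: _]) E15) (interp_plain E12) /interps /= cats0 enc_dvarE.
- rewrite [RHS]/= enc_numeral [LHS]/= !interps_cons /interps [flatten [::]]/= cats0.
  congr (_ ++ _); rewrite /interp; move: succ_word => w.
  have <- : size (s (numsel_reg n)) = numsel_val M T x n.
    by case: n => /=; rewrite ?E3 ?E9 ?size_nseq.
  rewrite -size_rev; elim: (rev _) => //= b u ->.
  by rewrite if_same.
- by rewrite /= interps_cons /interps /= cats0.
- by rewrite [LHS]/= interps_cons interps_cat IH1 IH2.
- by rewrite [LHS]/= !interps_cons (interp_plain E13) /interps [flatten [::]]/= cats0.
- by rewrite [LHS]/= !interps_cons (interp_plain E13) IH.
Qed.

Lemma interps_form f : interps s (form_items f) = enc_pform (form_of M T x f).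
Proof.
elim: f => [t1 t2|t1 t2|f IH|f1 IH1 f2 IH2|f1 IH1 f2 IH2];
  rewrite [LHS]/= interps_cons ?interps_cat ?interps_term ?IH ?IH1 ?IH2 //.
Qed.

(** In prefix notation the words of the blocks, each headed by the code of [PAnd], need only be
    juxtaposed; [ptrue] closes the conjunction. *)
Definition block_word (x : point N) : seq bool :=
  [:: false; true; true] ++ enc_pform (form_of M T x block).

Definition names_word (x : point N) : seq bool :=
  flatten [seq [:: true; false; true] ++ enc_nat k | k <- names x].

Lemma interps_block_items : interps s block_items = block_word x.
Proof. by rewrite /block_items interps_cons interps_form. Qed.

Lemma interps_names_items : interps s names_items = names_word x.
Proof.
rewrite /names_items /names_word /names.
elim: (form_auxs block) => [//|[[f t] v] ps IH].
rewrite [LHS](_ : _ = interps s ((Lit [:: true; false; true] :: name_items f t v) ++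
  flatten [seq Lit [:: true; false; true] :: name_items p.1.1 p.1.2 p.2 | p <- ps])) //.
by rewrite interps_cat interps_cons interps_name IH.
Qed.

End Represents.

Definition mapped_regs : seq nat := [:: 1; 3; 5; 7; 9; 11; 12; 13; 14; 15].

Definition item_mapped (it : item) : bool :=
  if it is Map r _ _ then r \in mapped_regs else true.

Definition atom_pass (its : seq item) : cmd := each_atom 10 14 11 15 12 13 (emit its).
Definition time_pass (its : seq item) : cmd :=
  each_bit 3 8 9 (Then (atom_pass its) (Push 9 true)).
(** The index of the negative end goes to register 7 and becomes the pivot; the other fields go to
    registers 17 to 20, away from those of the inner loop over atoms. *)
Definition pivot_pass (its : seq item) : cmd := each_atom 6 19 17 20 7 18 (time_pass its).
Definition length_pass (its : seq item) : cmd :=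
  each_bit 1 4 5 (Then (Push 5 true) (pivot_pass its)).

Definition empty_on (rs : seq nat) (s : store) : Prop :=
  forall r, r \in rs -> s r = [::].

Lemma empty_same rs xs s s' : same_except xs s s' -> empty_on rs s ->
  all (fun r => r \notin xs) rs -> empty_on rs s'.
Proof. by move=> H E /allP A r Hr; rewrite H ?A ?E. Qed.

Lemma foldl_flatten_map (A B C : Type) (g : B -> C -> B) z (h : A -> seq C) xs :
  foldl g z (flatten (map h xs)) = foldl (fun acc i => foldl g acc (h i)) z xs.
Proof. by elim: xs z => //= x xs IH z; rewrite foldl_cat IH. Qed.

Lemma foldl_map (A B C : Type) (g : B -> C -> B) z (h : A -> C) xs :
  foldl g z (map h xs) = foldl (fun acc i => g acc (h i)) z xs.
Proof. by elim: xs z => //= x xs IH z; rewrite IH. Qed.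

Lemma eq_foldl (A B : Type) (g h : B -> A -> B) z xs :
  (forall z x, g z x = h z x) -> foldl g z xs = foldl h z xs.
Proof. by move=> gh; elim: xs z => //= x xs IH z; rewrite gh IH. Qed.

Section Passes.
Variables (N : nat) (R : dbc N) (its : seq item) (word : point N -> seq bool).
Let w := enc_dbc R.
Let M := size w.
Let T := M * M.
Hypothesis its_mapped : all item_mapped its.
Hypothesis its_word : forall s x, represents M T s x -> interps s its = word x.

Let cost := items_cost its * (T + M).+1.
Let cost4 := M * (cost + 20 * M + 60) + 10.
Let cost3 := T * (cost4 + 2 + 11) + 4.
Let cost2 := M * (cost3 + 20 * M + 60) + 10.
Let cost1 := M * (2 + cost2 + 11) + 4.

Definition base (s : store) : Prop := s 1 = w /\ s 3 = nseq T true.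

Lemma runs_atom_pass l (v : 'I_N) t s : base s -> l <= M -> t <= T ->
  size (enc_nat v) <= M ->
  s 5 = nseq l true -> s 7 = rev (enc_nat v) -> s 9 = nseq t true ->
  empty_on [:: 2; 10; 11; 12; 13; 14; 15; 16] s ->
  runs (atom_pass its) s
    (upd s 0 (foldl (fun acc a => word (Point l v t a) ++ acc) (s 0) R)) cost4.
Proof.
move=> [s1 s3] lM tT vM s5 s7 s9 E.
have H := @runs_each_atom N R 10 14 11 15 12 13 (emit its)
  (fun a acc => word (Point l v t a) ++ acc) s cost.
apply: H => //; try by apply: E.
move=> a s' aR same h14 h11 h15 h12 h13.
have sx : represents M T s' (Point l v t a).
  by split=> //; rewrite !same //; split=> //; rewrite s1.
rewrite -(its_word sx); apply: runs_emit.
- apply: sub_all its_mapped => -[] //= r _ _.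
  have A : all (fun r => (r != 0) && (r != 2)) mapped_regs by [].
  by move/(allP A).
- by rewrite same // E.
have sz := size_enc_datom aR; have [bi bj bc] := enc_datom_parts a.
have le u : size u <= size (enc_datom a) -> size u <= T + M.
  by move=> h; apply: leq_trans h (leq_trans (ltnW sz) _); rewrite leq_addl.
have M0 : 0 < T + M by rewrite addn_gt0 (leq_ltn_trans _ sz) ?orbT.
apply: sub_all its_mapped => -[] //= r _ _.
case: sx => -[E1 E3 E5] E7 E9 [E11 E12 E13] [E14 E15].
(* Registers 3 and 9 hold at most [T] marks, the others at most [M] symbols. *)
have A : all (fun r => size (s' r) <= T + M) mapped_regs.
  have lS : l <= T + M by apply: leq_trans lM (leq_addl _ _).
  have vS : size (enc_nat v) <= T + M by apply: leq_trans vM (leq_addl _ _).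
  have tS : t <= T + M by apply: leq_trans tT (leq_addr _ _).
  rewrite /= E1 E3 E5 E7 E9 E11 E12 E13 E14 E15 !size_rev !size_nseq.
  by do !(apply/andP; split) => //; rewrite ?leq_addl ?leq_addr //; apply: le.
by move/(allP A).
Qed.

Lemma runs_time_pass l (v : 'I_N) s : base s -> l <= M -> size (enc_nat v) <= M ->
  s 5 = nseq l true -> s 7 = rev (enc_nat v) ->
  empty_on [:: 2; 8; 9; 10; 11; 12; 13; 14; 15; 16] s ->
  runs (time_pass its) s
    (upd s 0 (foldl (fun acc t =>
       foldl (fun acc a => word (Point l v t a) ++ acc) acc R) (s 0) (iota 0 T))) cost3.
Proof.
move=> [s1 s3] lM vM s5 s7 E.
have := @runs_each_bit 3 8 9 (Then (atom_pass its) (Push 9 true))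
  (fun t acc => foldl (fun acc a => word (Point l v t a) ++ acc) acc R) s (cost4 + 2).
rewrite s3 size_nseq; apply => //; try by apply: E.
move=> t s' tT same s9.
have b' : base s' by split; rewrite same.
have E' : empty_on [:: 2; 10; 11; 12; 13; 14; 15; 16] s'.
  apply: (empty_same same) => //; move=> r Hr; apply: E.
  by move: r Hr; apply/allP.
have s5' : s' 5 = nseq l true by rewrite same.
have s7' : s' 7 = rev (enc_nat v) by rewrite same.
have H := runs_atom_pass b' lM (ltnW tT) vM s5' s7' s9 E'.
by apply: (runs_cast (runs_then H (runs_push 9 true _))) => //; rewrite upd_other // s9; store_ext.
Qed.

Lemma runs_pivot_pass l s : base s -> l <= M -> s 5 = nseq l true ->
  empty_on [:: 2; 6; 7; 8; 9; 10; 11; 12; 13; 14; 15; 16; 17; 18; 19; 20] s ->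
  runs (pivot_pass its) s
    (upd s 0 (foldl (fun acc c => foldl (fun acc t =>
       foldl (fun acc a => word (Point l (dvar_index (d_neg c)) t a) ++ acc) acc R)
         acc (iota 0 T)) (s 0) R)) cost2.
Proof.
move=> [s1 s3] lM s5 E.
have H := @runs_each_atom N R 6 19 17 20 7 18 (time_pass its)
  (fun c acc => foldl (fun acc t =>
       foldl (fun acc a => word (Point l (dvar_index (d_neg c)) t a) ++ acc) acc R)
         acc (iota 0 T)) s cost3.
apply: H => //; try by apply: E.
move=> c s' cR same h19 h17 h20 h7 h18.
apply: runs_time_pass => //.
- by split; rewrite same.
- have [_ bj _] := enc_datom_parts c.
  by apply: leq_trans bj (ltnW (size_enc_datom cR)).
- by rewrite same.
- apply: (empty_same same) => //; move=> r Hr; apply: E.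
  by move: r Hr; apply/allP.
Qed.

Lemma runs_length_pass s : base s ->
  empty_on [:: 2; 4; 5; 6; 7; 8; 9; 10; 11; 12; 13; 14; 15; 16; 17; 18; 19; 20] s ->
  runs (length_pass its) s
    (upd s 0 (flatten [seq word x | x <- rev (points R M T)] ++ s 0)) cost1.
Proof.
move=> [s1 s3] E.
have H := @runs_each_bit 1 4 5 (Then (Push 5 true) (pivot_pass its))
  (fun l acc => foldl (fun acc c => foldl (fun acc t =>
       foldl (fun acc a => word (Point l.+1 (dvar_index (d_neg c)) t a) ++ acc) acc R)
         acc (iota 0 T)) acc R) s (2 + cost2).
rewrite s1 -/M in H.
apply: (runs_cast (H _ _ _ _ _)) => //; try by apply: E.
- move=> l s' lM same s5'.
  apply: (runs_cast (runs_then (runs_push 5 true _) (runs_pivot_pass (l := l.+1) _ _ _ _))) => //.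
  + by split; rewrite /upd /= same.
  + by rewrite upd_same s5'.
  + move=> r Hr; have r5 : r != 5 by move: r Hr; apply/allP.
    rewrite upd_other // same ?E //.
      by move: r Hr {r5}; apply/allP.
    by move: r Hr {r5}; apply/allP.
  + by rewrite s5'; store_ext.
- congr upd; rewrite /points.
  have prepend z xs : foldl (fun acc x => word x ++ acc) z xs =
      flatten [seq word x | x <- rev xs] ++ z.
    elim: xs z => //= x xs IH z.
    by rewrite IH rev_cons map_rcons flatten_rcons -catA.
  rewrite -prepend.
  rewrite foldl_flatten_map (iotaDl 1 0) foldl_map; apply: eq_foldl => z l.
  rewrite foldl_flatten_map; apply: eq_foldl => {}z c.
  rewrite foldl_flatten_map; apply: eq_foldl => {}z t.
  by rewrite foldl_map add1n.
Qed.

End Passes.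

(** The detour over stack 2 preserves the order and frees stack 0 for the output. *)
Definition load_input : cmd :=
  Then (Loop 0 (Push 2 true) (Push 2 false)) (Loop 2 (Push 1 true) (Push 1 false)).

Definition square_input : cmd :=
  let count := Then (copy 1 8) (Loop 8 (Push 3 true) (Push 3 true)) in
  Then (copy 1 4) (Loop 4 count count).

Lemma runs_square_input s M : size (s 1) = M -> empty_on [:: 2; 3; 4; 8] s ->
  runs square_input s (upd s 3 (nseq (M * M) true)) (M * (11 * M + 4) + 8 * M + 3).
Proof.
move=> s1 E.
have e3 : s 3 = [::] by apply: E.
have e4 : s 4 = [::] by apply: E.
pose st (u v : seq bool) := upd (upd s 4 v) 3 (nseq (size u * M) true).
have count s0 : s0 1 = s 1 -> s0 2 = [::] -> s0 8 = [::] ->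
  runs (Then (copy 1 8) (Loop 8 (Push 3 true) (Push 3 true))) s0
     (upd s0 3 (nseq M true ++ s0 3)) (11 * M + 3).
  move=> e1 e2 e8.
  have H1 : runs (copy 1 8) s0 _ _ := @runs_copy 1 8 s0 _ _ _ e2 e8.
  pose st8 (u v : seq bool) := upd (upd s0 8 v) 3 (nseq (size u) true ++ s0 3).
  have H2 := @runs_loop 8 (Push 3 true) (Push 3 true) st8 (s 1) 2.
  have Es : st8 [::] (s 1) = upd s0 8 (s0 1) by rewrite e1 /st8; store_ext.
  rewrite Es in H2.
  apply: (runs_cast (runs_then (H1 _ _ _) (H2 _ _))) => //.
  - move=> u b v _; split=> //.
    rewrite if_same; apply: (runs_cast (runs_push _ _ _)) => //.
    by rewrite /st8 size_rcons; store_ext.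
  - by rewrite /st8 s1; store_ext.
  - by rewrite e1 s1; clear; lia.
have H := @runs_loop 4 (Then (copy 1 8) (Loop 8 (Push 3 true) (Push 3 true)))
  (Then (copy 1 8) (Loop 8 (Push 3 true) (Push 3 true))) st (s 1) (11 * M + 3).
have Es : st [::] (s 1) = upd s 4 (s 1) by rewrite /st mul0n; store_ext.
rewrite Es in H.
apply: (runs_cast (runs_then (@runs_copy 1 4 s _ _ _ _ _) (H _ _))) => //;
  try by apply: E.
- move=> u b v _; split=> //; rewrite if_same.
  apply: (runs_cast (count _ _ _ _)) => //; try by apply: E.
  by rewrite /st size_rcons mulSn nseqD; store_ext.
- by rewrite /st s1; store_ext.
- by rewrite s1 addnS; clear; lia.
Qed.

(** The output grows from its end: the closing [ptrue], then the blocks, then the quantifiers. The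
    word of [ptrue] is the same for every number of variables, so 0 serves for all. *)
Definition main : cmd :=
  Then load_input (Then square_input
    (Then (pushes (enc_pform (ptrue 0)))
      (Then (length_pass block_items) (length_pass names_items)))).

Lemma uses_below_main : uses_below 21 main.
Proof. by vm_compute. Qed.

Lemma enc_formula (N : nat) M T (xs : seq (point N)) :
  flatten [seq names_word x | x <- xs] ++ flatten [seq block_word M T x | x <- xs] ++
    enc_pform (ptrue N) = enc_pform (formula M T xs).
Proof.
have flatten1 (A : Type) (u : seq A) us : flatten (u :: us) = u ++ flatten us by [].
have -> : flatten [seq block_word M T x | x <- xs] ++ enc_pform (ptrue N) =
    enc_pform (conj_blocks M T xs).
  elim: xs => [//|x xs IH].
  by rewrite map_cons flatten1 -catA IH.
rewrite /formula; move: (conj_blocks M T xs) => g.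
have prefix ks h : enc_pform (foldr (@PEx N) h ks) =
    flatten [seq [:: true; false; true] ++ enc_nat k | k <- ks] ++ enc_pform h.
  by elim: ks => //= k ks ->; rewrite catA.
elim: xs => [//|x xs IH].
by rewrite !map_cons !flatten1 -catA IH foldr_cat [RHS]prefix.
Qed.

(** * The polynomial time bound *)

Definition pass_cost (c M : nat) : nat :=
  M * (2 + (M * ((M * M) * ((M * (c * (M * M + M).+1 + 20 * M + 60) + 10) + 2 + 11) + 4
    + 20 * M + 60) + 10) + 11) + 4.

Definition main_cost (M : nat) : nat :=
  (3 * M + 1) + (3 * M + 1) + (M * (11 * M + 4) + 8 * M + 3 +
    (2 * size (enc_pform (ptrue 0)) + 1 +
      (pass_cost (items_cost block_items) M + pass_cost (items_cost names_items) M))).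

(** The cost is built from constants and its argument by sums, products and successors, under which
    polynomial functions on [nat] are closed. *)
Lemma polynomial_main_cost : exists p : {poly nat}, forall n, main_cost n = (p.[n])%R.
Proof.
pose P f := exists p : {poly nat}, forall n : nat, f n = (p.[n])%R :> nat.
have PC c : P (fun=> c) by exists (c%:P)%R => n; rewrite hornerC.
have PX : P id by exists ('X)%R => n; rewrite hornerX.
have PD f g : P f -> P g -> P (fun n => f n + g n).
  by move=> [p Hp] [q Hq]; exists (p + q)%R => n; rewrite hornerD Hp Hq.
have PM f g : P f -> P g -> P (fun n => f n * g n).
  by move=> [p Hp] [q Hq]; exists (p * q)%R => n; rewrite hornerM Hp Hq.
have PS f : P f -> P (fun n => (f n).+1).
  move=> Hf; have [p Hp] := PD _ _ Hf (PC 1); exists p => n.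
  by rewrite -Hp addn1.
have Ppass c : P (pass_cost c).
  by rewrite /pass_cost; do !first [exact: PC | exact: PX | apply: (PS _) | apply: (PD _ _) | apply: (PM _ _)].
rewrite -/(P main_cost) /main_cost; move: (items_cost _) (items_cost _) (size _) => a b c.
by do !first [exact: PC | exact: PX | exact: Ppass | apply: (PS _) | apply: (PD _ _) | apply: (PM _ _)].
Qed.

Lemma runs_main (N : nat) (R : dbc N) :
  let M := size (enc_dbc R) in
  exists2 s' : store, s' 0 = enc_pform (formula M (M * M) (rev (points R M (M * M)))) &
  runs main (input_store (enc_dbc R)) s' (main_cost M).
Proof.
set w := enc_dbc R => M.
have RM : size w = M by [].
pose s1 := upd (input_store w) 1 w; pose s1' := upd s1 0 [::].
have H1 : runs load_input (input_store w) s1' ((3 * M + 1) + (3 * M + 1)).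
  have D1 := @runs_drain 0 2 (input_store w) w (fun e => ltac:(discriminate)) (erefl _).
  set t1 := upd _ 2 _ in D1.
  have t12 : t1 2 = rev w by exact: cats0.
  have D2 := @runs_drain 2 1 t1 (rev w) (fun e => ltac:(discriminate)) t12.
  apply: (runs_cast (runs_then D1 D2)) => //; last by rewrite size_rev RM mulnC.
  rewrite revK /t1 /s1' /s1.
  by apply: functional_extensionality => -[|[|[|x]]]; rewrite /upd /= ?cats0.
have E1 r : r != 1 -> s1' r = [::] by case: r => [|[]].
have H2 : runs square_input s1' (upd s1' 3 (nseq (M * M) true))
    (M * (11 * M + 4) + 8 * M + 3).
  by apply: runs_square_input => // r; rewrite !inE => /or4P[] /eqP ->.
set s2 := upd s1' 3 _ in H2.
have H3 := runs_pushes (enc_pform (ptrue 0)) s2; set s3 := upd s2 0 _ in H3.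
have E3 r : r \notin [:: 0; 1; 3] -> s3 r = [::].
  by rewrite !inE !negb_or => /and3P[r0 r1 r3]; rewrite /s3 upd_other // /s2 upd_other // E1.
have B3 : base R s3 by [].
have mapped1 : all item_mapped block_items by vm_compute.
have mapped2 : all item_mapped names_items by vm_compute.
have word1 s (x : point N) : represents M (M * M) s x -> interps s block_items = block_word M (M * M) x.
  exact: interps_block_items.
have word2 s (x : point N) : represents M (M * M) s x -> interps s names_items = names_word x.
  exact: interps_names_items.
have nil3 : empty_on [:: 2; 4; 5; 6; 7; 8; 9; 10; 11; 12; 13; 14; 15; 16; 17; 18; 19; 20] s3.
  by move=> r Hr; apply: E3; move: r Hr; apply/allP.
have H4 := runs_length_pass mapped1 word1 B3 nil3.
set s4 := upd s3 0 _ in H4.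
have B4 : base R s4 by [].
have nil4 : empty_on [:: 2; 4; 5; 6; 7; 8; 9; 10; 11; 12; 13; 14; 15; 16; 17; 18; 19; 20] s4.
  move=> r Hr; rewrite /s4 upd_other ?nil3 //.
  by move: r Hr; apply/allP.
have H5 := runs_length_pass mapped2 word2 B4 nil4.
set s5 := upd s4 0 _ in H5.
exists s5; last by have := runs_then H1 (runs_then H2 (runs_then H3 (runs_then H4 H5))).
by rewrite -enc_formula /s5 upd_same /s4 upd_same /s3 upd_same.
Qed.

Local Open Scope ring_scope.

Theorem theorem1 :
  exists (M : turing_machine) (p : {poly nat}),
    forall (N : nat) (R : dbc N), one_directional R ->
      exists f : pform N,
        [/\ existential f,
            closed_form R f &
            outputs_within M (enc_dbc R) (enc_pform f)
              p.[size (enc_dbc R)]].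
Proof.
have [TM HTM] := stack_program_machine uses_below_main.
have [p Hp] := polynomial_main_cost.
exists TM, p => N R dirR; set M := size (enc_dbc R).
exists (formula M (M * M) (rev (points R M (M * M)))); split.
- exact: existential_formula.
- exact: closed_form_formula dirR (size_dbc R) _.
have [s' <- Hrun] := runs_main R.
by case: Hrun => n Ln Hrun; apply: HTM Hrun _; rewrite -Hp.
Qed.
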